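(* Let $p>2$ be a prime and let $G$ be a finite $p$-group of conjugate type $\{1,p^3\}$. Let $t$ be any fixed integer that is a non-square modulo $p$. Then the nilpotency class of $G$ is $2$, and $G$ is isoclinic to one of the following groups: (i) a finite Camina $p$-group of nilpotency class $2$ with commutator subgroup of order $p^3$; (ii) the group $G_3$; (iii) the quotient group $G_3/M$, where $M$ is the normal subgroup of $G_3$ given by $M=\langle [a,b][c,d]\rangle$; (iv) the quotient group $G_3/N$, where $N$ is the normal subgroup of $G_3$ given by $N=\langle [a,b][c,d],\ [a,c][b,d]^t\rangle$.
   Context: A finite group is of conjugate type $\{m_1,\dots,m_n\}$ if the set of its conjugacy class sizes is exactly $\{m_1,\dots,m_n\}$. The commutator is $[x,y]=x^{-1}y^{-1}xy$; $G'$ is the commutator subgroup. Two finite groups $G,H$ are isoclinic if there are isomorphisms $\phi: G/Z(G)\to H/Z(H)$ and $\theta: G'\to H'$ such that $\theta([x,y])=[x',y']$ whenever $x,y\in G$, $x'\in\phi(xZ(G))$ and $y'\in\phi(yZ(G))$. A finite group $G$ is a Camina group if $x^G=xG'$ for all $x\in G\setminus G'$, where $x^G$ is the conjugacy class of $x$. For $r\ge 1$ and an odd prime $p$, $G_r$ is the group with generators $a_1,\dots,a_{r+1}$ and relations $[a_i,a_j]=b_{ij}$, $[a_k,b_{ij}]=1$, $a_k^p=1$, $b_{ij}^p=1$ for $1\le i<j\le r+1$, $1\le k\le r+1$. The generators $a_1,a_2,a_3,a_4$ of $G_3$ are denoted $a,b,c,d$ respectively. *)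

(* Defs.v *)
From HB Require Import structures.
From mathcomp Require Import all_boot all_order all_fingroup all_algebra all_solvable.

Set Implicit Arguments.
Unset Strict Implicit.
Unset Printing Implicit Defensive.

Local Open Scope group_scope.

Definition conjugate_type (gT : finGroupType) (G : {group gT}) (s : seq nat) : Prop :=
  [seq #|xG| | xG : {set gT} in classes G] =i s.

(* Elements of a quotient are cosets, hence sets: [x' \in phi (coset 'Z(G) x)]
   is membership of an element of [H] in a coset of ['Z(H)]. *)
Definition isoclinic (gT hT : finGroupType) (G : {group gT}) (H : {group hT}) : Prop :=
  exists (phi : {morphism G / 'Z(G) >-> coset_of 'Z(H)})
         (theta : {morphism G^`(1) >-> hT}),
    [/\ isom (G / 'Z(G)) (H / 'Z(H)) phi,
        isom G^`(1) H^`(1) theta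
      & forall (x y : gT) (x' y' : hT), x \in G -> y \in G ->
          x' \in (phi (coset 'Z(G) x) : {set hT}) ->
          y' \in (phi (coset 'Z(G) y) : {set hT}) ->
          theta [~ x, y] = [~ x', y'] ].

Definition camina (gT : finGroupType) (G : {group gT}) : Prop :=
  forall x, x \in G :\: G^`(1) -> x ^: G = x *: G^`(1).

Definition G_relations (p r : nat) (gT : groupType) (a : r.+1.-tuple gT) : Prop :=
  [/\ forall i j k : 'I_r.+1, i < j ->
        [~ tnth a k, [~ tnth a i, tnth a j]] = 1,
      forall k : 'I_r.+1, tnth a k ^+ p = 1
    & forall i j : 'I_r.+1, i < j -> [~ tnth a i, tnth a j] ^+ p = 1 ].

(* [G] is the group presented by the relations [G_relations p r], with
   generators [a]: it is generated by [a], the relations hold, and (von Dyck)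
   any family satisfying them in an arbitrary, possibly infinite, group is the
   image of [a] under a homomorphism. This determines [(G, a)] up to unique
   isomorphism. *)
Definition presented_G (p r : nat) (gT : finGroupType) (G : {group gT})
    (a : r.+1.-tuple gT) : Prop :=
  [/\ G :=: <<[set x in a]>>,
      G_relations p a
    & forall (hT : groupType) (b : r.+1.-tuple hT), G_relations p b ->
        exists2 f : gT -> hT,
          {in G &, {morph f : x y / x * y}}
          & forall i, f (tnth a i) = tnth b i ].

Definition expgz (gT : groupType) (x : gT) (n : int) : gT :=
  match n with
  | Posz m => x ^+ m
  | Negz m => x ^- m.+1
  end.

Definition square_mod (p : nat) (t : int) : Prop :=
  exists s : int, (s ^+ 2 = t %[mod p])%Z.

(* Main.v *)
(** Let [Z] be the centre of [G]. Minimality of the class sizes forces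
    [[K, G] <= Z] for every abelian normal subgroup [K]: if [y = [k, x]] were not
    central, then [C_G(y)] would contain [K C_D(y)] with [D = C_G(x)], so [y] would
    have at least [|[K, x]|] conjugates under [D], all of them in [[K, x] \ {1}].
    Applied to a self-centralising abelian normal subgroup this bounds the class by 3.
    Class 3 is excluded by counting commuting pairs in [G x G'], according to the
    index of [G' & Z] in [G'].

    In class 2 write [D x = [x, G]], a group of order [p^3] when [x] is not central.
    A pencil argument on [x y] and [x^2 y] gives [D z <= D x] whenever [z] commutes
    with [x], so the sets [{g | D g <= D x}] partition [G / Z] into subspaces of
    codimension at most 3. Hence either [G'] has order [p^3], or [|G / Z| = p^4].
    Isoclinism only sees the alternating map [G/Z x G/Z -> G']; in the first case half
    of it is a cocycle for a Camina group. In the second case the map is a quotient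
    of the exterior square of [F_p^4] by a subspace containing no nonzero decomposable
    bivector, of dimension at most 2, and a basis of [F_p^4] is chosen in which this
    subspace is spanned by the relators. *)

Require Import Defs.
From HB Require Import structures.
From mathcomp Require Import all_boot all_order all_fingroup all_algebra all_solvable.
From mathcomp Require Import mxabelem.
From mathcomp Require Import zify ring.

Set Implicit Arguments.
Unset Strict Implicit.
Unset Printing Implicit Defensive.

Local Open Scope group_scope.

(** * Nilpotency class at most three *)

(** Two facts recur below the surface. A nondegenerate alternating form has even rank; this settles
    the case of class 3 that counting leaves open and one of the two dimensions that the partition
    into subspaces does not exclude. And a bivector of a 4-space is decomposable exactly when its
    Pfaffian vanishes: on [alpha (e12 + e34) + beta (e13 + t e24)] the Pfaffian is
    [alpha^2 - t beta^2], which is where the non-square [t] comes from. At most two relations occur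
    because the second case has [|G'| > p^3], so at least 4 of the 6 dimensions of the exterior
    square survive. Oddness of [p] enters in the last inequality against class 3, in cancelling a
    square in the pencil argument, in halving the alternating map, and in splitting a coefficient
    evenly when the second relation is normalised. The presentation of [G_3] is tested against
    arbitrary groups, so a concrete finite model is built and the collection process is carried out
    by hand in a possibly infinite group. *)

Section TwoClassSizes.

Variables (gT : finGroupType) (G : {group gT}) (q : nat).
Hypothesis classG : forall x, x \in G -> x \notin 'Z(G) -> #|x ^: G| = q.

Lemma card_cent1_noncentral x :
  x \in G -> x \notin 'Z(G) -> (#|'C_G[x]| * q)%N = #|G|.
Proof.
move=> Gx nZx; rewrite -(classG Gx nZx) -index_cent1 Lagrange //.
exact: subsetIl.
Qed.

Lemma commg_abelian_normal_central (K : {group gT}) :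
  K <| G -> abelian K -> [~: K, G] \subset 'Z(G).
Proof.
move=> nKG abK; have sKG := normal_sub nKG.
rewrite gen_subG; apply/subsetP=> _ /imset2P[k x Kk Gx ->].
have Gk := subsetP sKG k Kk.
case Zx: (x \in 'Z(G)).
  have /commgP/eqP->: commute k x by case/centerP: Zx => _ /(_ k Gk) /commute_sym.
  exact: group1.
apply: contraT => nZy; set y := [~ k, x] in nZy *.
have Kcom z : z \in K -> [~ z, x] \in K.
  move=> Kz; rewrite commgEl groupM ?groupV // memJ_norm //.
  exact: subsetP (normal_norm nKG) x Gx.
have fM : {in K &, {morph (fun z => [~ z, x]) : a b / a * b}}.
  move=> a b Ka Kb /=; rewrite commMgJ; congr (_ * _).
  apply/conjg_fixP/commgP; apply: (centsP abK) => //; exact: Kcom.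
pose f := Morphism fM.
have kerf : 'ker f = K :&: 'C_G[x].
  apply/eqP; rewrite eqEsubset; apply/andP; split; apply/subsetP=> z.
    move=> kz; have Kz := dom_ker kz.
    rewrite !in_setI Kz (subsetP sKG z Kz) /=; apply/cent1P.
    by have /eqP/commgP := mker kz.
  case/setIP=> Kz /setIP[_ /cent1P cxz]; apply/kerP => //.
  by apply/eqP/commgP.
have Ky : y \in K by apply: Kcom.
have Gy := subsetP sKG y Ky.
pose D := 'C_G[x]%G; pose E := 'C_D[y]%G.
have sDG : D \subset G by apply: subsetIl.
have KE : K :&: E = 'ker f.
  rewrite kerf /E /= setIA; apply/setIidPl.
  apply/subsetP=> z; rewrite inE => /andP[Kz _]; apply/cent1P.
  exact: (centsP abK).
have sKEy : K * E \subset 'C_G[y].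
  rewrite mul_subG // ?setSI // subsetI sKG /=.
  by rewrite sub_cent1; apply: subsetP Ky; exact: abK.
have cardKE : #|K * E| = (#|f @* K| * #|E|)%N.
  have := mul_cardG K E; rewrite KE => cE.
  have cK : #|K| = (#|f @* K| * #|'ker f|)%N.
    by rewrite card_morphim setIid mulnC Lagrange ?subsetIl.
  apply/eqP; rewrite -(eqn_pmul2r (cardG_gt0 ('ker f))) -cE cK.
  by rewrite mulnAC.
(* Equal class sizes enter here: [x] and [y] are both noncentral, so [C_G(y)] has the order of
   [D = C_G(x)]. *)
have cardD : #|'C_G[y]| = (#|y ^: D| * #|E|)%N.
  rewrite -index_cent1 mulnC Lagrange ?subsetIl //.
  have q_gt0 : 0 < q by rewrite -(classG Gy nZy) (cardD1 y) class_refl.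
  apply/eqP; rewrite -(eqn_pmul2r q_gt0) (card_cent1_noncentral Gy nZy).
  by rewrite card_cent1_noncentral ?Zx.
have: #|f @* K| <= #|y ^: D|.
  by rewrite -(leq_pmul2r (cardG_gt0 E)) -cardKE -cardD subset_leq_card.
(* The contradiction is a difference of one: the image of [f] contains 1, while the conjugates of
   [y] under [D] lie in that image and avoid 1. *)
rewrite leqNgt => /negP[]; rewrite (cardsD1 1 (f @* K)) group1 add1n ltnS.
apply/subset_leq_card/subsetP=> _ /imsetP[d Dd ->]; rewrite !inE.
have [Gd cxd] := setIP Dd.
have xd : x ^ d = x by apply/conjg_fixP/commgP/cent1P; rewrite cent1C in cxd.
rewrite conjg_eq1; apply/andP; split.
  by apply: contraNneq nZy => ->; apply: group1.
have Kkd : k ^ d \in K by rewrite memJ_norm // (subsetP (normal_norm nKG)).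
by rewrite /y conjRg xd; apply: (mem_morphim f).
Qed.

Variable p : nat.
Hypothesis pG : p.-group G.

(** A maximal abelian normal subgroup [A] of a [p]-group is its own centraliser. Since [[A, G, G] =
    1], the three subgroups lemma gives [[G', A] = 1], hence G' lies in [A] and inherits both
    properties. *)
Lemma der1_abelian_comm_central : abelian G^`(1) /\ [~: G^`(1), G] \subset 'Z(G).
Proof.
have [A maxA] : {A : {group gT} | [max A | (A <| G) && abelian A]}.
  by apply: ex_maxgroup; exists 1%G; rewrite normal1 abelian1.
have [nAG abA] := andP (maxgroupp maxA).
have CA := SCN_P (max_SCN pG maxA); case: CA => _ CA.
have cAG := commg_abelian_normal_central nAG abA.
have cAG1 : [~: A, G, G] = 1.
  by apply/commG1P; apply: subset_trans cAG _; rewrite subsetIr.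
have sG'A : G^`(1) \subset A.
  rewrite -CA subsetI der_sub /=; apply/commG1P.
  by rewrite (three_subgroup _ cAG1) // (commGC G).
split; first exact: abelianS sG'A abA.
by apply: subset_trans cAG; apply: commSg.
Qed.

(** If [x] centralises G', then [x] and G' together generate an abelian normal subgroup, to which
    the centrality of commutators applies. *)
Lemma cent_der1_sub_ucn2 x :
  x \in 'C_G(G^`(1)) -> [~: [set x], G] \subset 'Z(G).
Proof.
case/setIP=> Gx Cx; have [abG' _] := der1_abelian_comm_central.
have nK : <[x]> <*> G^`(1) <| G.
  apply: sub_der1_normal; first exact: joing_subr.
  by rewrite join_subG cycle_subG Gx der_sub.
apply: subset_trans (commg_abelian_normal_central nK _); last first.
  by rewrite abelianY cycle_abelian abG' centsC cycle_subG.
by apply: commSg; rewrite sub1set mem_gen // inE cycle_id.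
Qed.

End TwoClassSizes.

(** * Exclusion of class three *)

Section IndexOfCenter.
Variables (gT : finGroupType) (p : nat).
Implicit Types G H : {group gT}.

Lemma class_sub_der1_lcoset H x : x \in H -> x ^: H \subset x *: H^`(1).
Proof.
move=> Hx; apply/subsetP=> _ /imsetP[g Hg ->].
by rewrite mem_lcoset -commgEl mem_commg.
Qed.

Lemma pgroup_index_pfactor G H :
  prime p -> p.-group G -> H \subset G -> exists n, #|G : H| = (p ^ n)%N.
Proof.
move=> p_pr pG sHG; case/p_natP: (pnat_dvd (dvdn_indexg G H) pG) => n ->.
by exists n.
Qed.

Lemma subgroup_eq_index G H (K : {group gT}) :
  H \subset K -> K \subset G -> #|G : H| <= #|G : K| -> H :=: K.
Proof.
move=> sHK sKG; rewrite -(Lagrange_index sKG sHK) => le.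
apply/eqP; rewrite eqEsubset sHK /= -indexg_eq1 eqn_leq indexg_gt0 andbT.
by rewrite -(leq_pmul2l (indexg_gt0 G K)) muln1.
Qed.

(** The commutator would be a nondegenerate alternating form on a space of dimension 3. The argument
    is phrased with centralisers, all of which have index [p] for noncentral elements. *)
Lemma index_center_der1_prime H :
  prime p -> #|H^`(1)| = p -> #|H : 'Z(H)| != (p ^ 3)%N.
Proof.
move=> p_pr cardH'; apply/eqP=> iZ.
have p_gt1 := prime_gt1 p_pr; have p_gt0 := prime_gt0 p_pr.
have sZH : 'Z(H) \subset H by apply: subsetIl.
have sZC x : x \in H -> 'Z(H) \subset 'C_H[x].
  by move=> Hx; rewrite setIS // -cent_set1 centS // sub1set.
have iC x : x \in H -> x \notin 'Z(H) -> #|H : 'C_H[x]| = p.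
  move=> Hx nZx; apply/eqP; rewrite eqn_leq; apply/andP; split.
    rewrite index_cent1 -cardH' -(card_lcoset _ x).
    exact/subset_leq_card/class_sub_der1_lcoset.
  have: #|H : 'C_H[x]| %| p ^ 3.
    by rewrite -iZ -(Lagrange_index (subsetIl H 'C[x]) (sZC x Hx)) dvdn_mulr.
  case/(dvdn_pfactor _ _ p_pr)=> [[|m] _ iE]; last first.
    by rewrite iE expnS leq_pmulr ?expn_gt0 ?p_gt0.
  move/eqP: iE; rewrite expn0 indexg_eq1 subsetI subxx sub_cent1 => cHx.
  by case/negP: nZx; rewrite inE Hx.
have [x Hx nZx] : exists2 x, x \in H & x \notin 'Z(H).
  apply/subsetPn; rewrite -indexg_eq1 iZ -(expn0 p) eqn_exp2l //.
have [y Hy nCxy] : exists2 y, y \in H & y \notin 'C[x].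
  by apply/subsetPn; apply: contra nZx; rewrite sub_cent1 => cHx; rewrite inE Hx.
have nZy : y \notin 'Z(H).
  by apply: contra nCxy => /centerP[_ /(_ x Hx) ?]; apply/cent1P/commute_sym.
pose Cx := 'C_H[x]%G; pose Cy := 'C_H[y]%G; pose A := (Cx :&: Cy)%G.
have cardH : #|H| = (p ^ 3 * #|'Z(H)|)%N by rewrite -iZ mulnC Lagrange.
have cardC z : z \in H -> z \notin 'Z(H) -> (p * #|'C_H[z]|)%N = #|H|.
  by move=> Hz nZz; rewrite -(iC z Hz nZz) mulnC Lagrange ?subsetIl.
have Z_gt0 : 0 < #|'Z(H)| by apply: cardG_gt0.
have cardCx : #|Cx| = (p ^ 2 * #|'Z(H)|)%N.
  by apply/eqP; rewrite -(eqn_pmul2l p_gt0) cardC // cardH expnS mulnA.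
have cardCy : #|Cy| = (p ^ 2 * #|'Z(H)|)%N.
  by apply/eqP; rewrite -(eqn_pmul2l p_gt0) cardC // cardH expnS mulnA.
have sZA : 'Z(H) \subset A by rewrite subsetI !sZC.
have sACx : A \subset Cx by apply: subsetIl.
have cardA : #|A| = (p * #|'Z(H)|)%N.
  have leA : p * #|'Z(H)| <= #|A|.
    have: #|Cx * Cy| <= #|H| by rewrite subset_leq_card // mul_subG ?subsetIl.
    rewrite -(leq_pmul2r (cardG_gt0 A)) -mul_cardG cardCx cardCy cardH.
    rewrite mulnACA -expnD (expnSr p 3) -mulnACA leq_pmul2l //.
    by rewrite muln_gt0 expn_gt0 p_gt0.
  have [k kE] : exists k, #|Cx : A| = (p ^ k)%N.
    have: #|Cx : A| %| p ^ 2.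
      have := Lagrange_index sACx sZA.
      have -> : #|Cx : 'Z(H)| = (p ^ 2)%N.
        have := Lagrange (subset_trans sZA sACx); rewrite cardCx mulnC => /eqP.
        by rewrite eqn_pmul2r // => /eqP.
      by move <-; rewrite dvdn_mulr.
    by case/(dvdn_pfactor _ _ p_pr)=> k _; exists k.
  have := Lagrange sACx; rewrite kE cardCx => cA.
  case: k kE cA => [|k] kE cA.
    have /eqP := kE; rewrite expn0 indexg_eq1 => /subsetP/(_ x).
    have -> : x \in Cx by rewrite inE Hx cent1id.
    move/(_ isT)/setIP=> [_ /setIP[_ ]]; rewrite cent1C => Cyx.
    by rewrite Cyx in nCxy.
  apply/eqP; rewrite eqn_leq leA andbT.
  rewrite -(leq_pmul2r p_gt0) [X in _ <= X]mulnC mulnA mulnn -cA leq_pmul2l ?cardG_gt0 //.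
  by rewrite expnS leq_pmulr // expn_gt0 p_gt0.
have abA : abelian A.
  apply: (@cyclic_factor_abelian _ 'Z(H)%G).
    rewrite subsetI sZA; apply: subset_trans (subsetIr _ _) _.
    by rewrite centS // (subset_trans sACx) ?subsetIl.
  apply: prime_cyclic; rewrite card_quotient; last first.
    by rewrite (subset_trans (subset_trans sACx (subsetIl _ _))) // gFnorm.
  suff -> : #|A : 'Z(H)| = p by [].
  by apply/eqP; rewrite -(eqn_pmul2l Z_gt0) Lagrange ?cardA // mulnC.
(* The two hyperplanes [Cx] and [Cy] meet in [A], still larger than the centre. A noncentral [z] in
   [A] turns out to have the same centraliser as [x], although [y] commutes with [z] and not with
   [x]. *)
have [z Az nZz] : exists2 z, z \in A & z \notin 'Z(H).
  apply/subsetPn/negP => /subset_leq_card; rewrite cardA leqNgt.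
  by rewrite -{1}[#|_|]mul1n ltn_pmul2r // p_gt1.
have [/setIP[Hz cxz] /setIP[_ cyz]] := setIP Az.
pose Cz := 'C_H[z]%G.
have sCxCz : Cx \subset Cz.
  pose B := (Cx :&: Cz)%G.
  have sAB : A \subset B.
    rewrite subsetI sACx subsetI (subset_trans sACx) ?subsetIl //= sub_cent1.
    by rewrite (subsetP abA).
  have sBCx : B \subset Cx by apply: subsetIl.
  have iA : #|Cx : A| = p.
    apply/eqP; rewrite -(eqn_pmul2l (cardG_gt0 A)) Lagrange // cardA cardCx.
    by rewrite mulnAC.
  have : #|Cx : B| %| p by rewrite -iA -(Lagrange_index sBCx sAB) dvdn_mulr.
  case/primeP: (p_pr) => _ H1 /H1 /orP[|/eqP iB].
    by rewrite indexg_eq1 subsetI => /andP[].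
  have BA : A :=: B by apply: (subgroup_eq_index sAB sBCx); rewrite iA iB.
  have : x \in B by rewrite !in_setI Hx cent1id /= cent1C.
  rewrite -BA => /setIP[_ /setIP[_]]; rewrite cent1C => Cyx.
  by rewrite Cyx in nCxy.
have CxE : Cx :=: Cz.
  by apply: (subgroup_eq_index sCxCz) (subsetIl _ _) _; rewrite !iC.
have : y \in Cz by rewrite inE Hy cent1C.
by rewrite -CxE inE (negPf nCxy) andbF.
Qed.

End IndexOfCenter.

(** * Centres modulo a normal subgroup *)

Section RelativeCenter.
Variables (gT : finGroupType).
Implicit Types G H M : {group gT}.

(** For [M = 'Z(G)] this is the second centre. In class 2, for [M] of index [p] in G', it is the
    radical of the alternating form that the commutator induces modulo [M]. *)
Definition relcenter G M := (coset M @*^-1 'Z(G / M))%G.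

Lemma relcenter_sub G M : M <| G -> relcenter G M \subset G.
Proof. by move=> nMG; rewrite sub_cosetpre_quo // subsetIl. Qed.

Lemma mem_relcenter G M x :
  M <| G -> x \in G -> (x \in relcenter G M) = ([~: [set x], G] \subset M).
Proof.
move=> nMG Gx; have nM := subsetP (normal_norm nMG) x Gx.
rewrite -sub1set -sub_quotient_pre ?sub1set //.
rewrite -quotient_cents2 ?sub1set ?normal_norm //.
by rewrite subsetI quotientS ?sub1set.
Qed.

Lemma relcenterP G M x : M <| G ->
  reflect (x \in G /\ forall g, g \in G -> [~ x, g] \in M) (x \in relcenter G M).
Proof.
move=> nMG; apply: (iffP idP) => [Rx|[Gx cx]].
  have Gx := subsetP (relcenter_sub nMG) x Rx; split=> // g Gg.
  by apply: subsetP (mem_commg (set11 x) Gg); rewrite -mem_relcenter.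
rewrite mem_relcenter // gen_subG; apply/subsetP=> _ /imset2P[y g /set1P-> Gg ->].
exact: cx.
Qed.

Lemma index_relcenter G M : M <| G -> #|G : relcenter G M| = #|G / M : 'Z(G / M)|.
Proof. by move=> nMG; rewrite -[X in #|X : _|](quotientGK nMG) index_cosetpre. Qed.

Lemma index_relcenter_not_prime G M p :
  prime p -> M <| G -> ~~ (G^`(1) \subset M) ->
  (#|G : relcenter G M| != 1%N) && (#|G : relcenter G M| != p).
Proof.
move=> p_pr nMG nG'M; rewrite index_relcenter //.
have nabG : ~~ abelian (G / M) by apply: contra nG'M => /(der1_min (normal_norm nMG)).
have nZ := center_normal (G / M).
apply/andP; split; apply: contra nabG => /eqP iZ.
  by apply: abelianS (center_abelian (G/M)); rewrite -indexg_eq1 iZ.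
apply: cyclic_center_factor_abelian; apply: prime_cyclic.
by rewrite card_quotient ?normal_norm // iZ.
Qed.

Lemma index_relcenter_der1 G M p :
  prime p -> M <| G -> M \subset G^`(1) -> #|G^`(1) : M| = p ->
  #|G : relcenter G M| != (p ^ 3)%N.
Proof.
move=> p_pr nMG sMG' iM; rewrite index_relcenter //.
apply: index_center_der1_prime => //.
rewrite -quotient_der ?normal_norm // card_quotient //.
exact: subset_trans (der_sub 1 G) (normal_norm nMG).
Qed.

End RelativeCenter.

Section ClassTwo.
Variables (gT : finGroupType) (G : {group gT}).
Hypothesis G2 : G^`(1) \subset 'Z(G).

Lemma class2_central x y g : x \in G -> y \in G -> g \in G -> commute g [~ x, y].
Proof.
move=> Gx Gy Gg; have /centerP[_] : [~ x, y] \in 'Z(G).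
  exact: subsetP G2 _ (mem_commg Gx Gy).
by move/(_ g Gg)/commute_sym.
Qed.

Lemma class2_commMg x y z : x \in G -> y \in G -> z \in G ->
  [~ x * y, z] = [~ x, z] * [~ y, z].
Proof.
move=> Gx Gy Gz; rewrite commMgJ; congr (_ * _).
by apply/conjg_fixP/commgP/commute_sym/class2_central.
Qed.

Lemma class2_commgM x y z : x \in G -> y \in G -> z \in G ->
  [~ x, y * z] = [~ x, y] * [~ x, z].
Proof.
move=> Gx Gy Gz; rewrite commgMJ.
have -> : [~ x, y] ^ z = [~ x, y].
  by apply/conjg_fixP/commgP/commute_sym/class2_central.
exact/class2_central/groupR.
Qed.

Lemma class2_commXg x y n : x \in G -> y \in G -> [~ x ^+ n, y] = [~ x, y] ^+ n.
Proof.
by move=> Gx Gy; apply: commXg; apply/class2_central.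
Qed.

(** In class 2 the map [g |-> [x, g]] is a homomorphism, so the commutators with [x] already form a
    group. *)
Lemma comm1E x : x \in G -> [~: [set x], G] = [set [~ x, g] | g in G].
Proof.
move=> Gx; have fM : {in G &, {morph (fun g => [~ x, g]) : a b / a * b}}.
  by move=> a b Ga Gb; apply: class2_commgM.
rewrite /commutator; have -> : commg_set [set x] G = Morphism fM @* G.
  rewrite morphimEdom; apply/setP=> y; apply/imset2P/imsetP.
    by case=> _ g /set1P-> Gg ->; exists g.
  by case=> g Gg ->; exists x g; rewrite ?set11.
by rewrite genGid /= morphimEdom.
Qed.

Lemma comm1P x y : x \in G ->
  reflect (exists2 g, g \in G & y = [~ x, g]) (y \in [~: [set x], G]).
Proof. by move=> Gx; rewrite comm1E //; apply: imsetP. Qed.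

Lemma card_comm1 x : x \in G -> #|[~: [set x], G]| = #|x ^: G|.
Proof.
move=> Gx; rewrite comm1E // -(card_imset _ (mulgI x)) -imset_comp.
by congr #|pred_of_set _|; apply: eq_imset => g /=; rewrite -conjg_mulR.
Qed.

Lemma comm1_sub x : x \in G -> [~: [set x], G] \subset G^`(1).
Proof. by move=> Gx; apply: commSg; rewrite sub1set. Qed.

End ClassTwo.

(** Double counting of the pairs [(x, m)] with [m] of order [p] in H' and [[x, H]] inside [<[m]>].
    An [x] with a small class occurs in at least [p - 1] pairs, given by the generators of one
    subgroup of order [p]. Each of the at most [p^2 - 1] elements [m] occurs in at most [|H| / p^2]
    pairs, because the quotient by [<[m]>] is not abelian and its centre has index at least
    [p^2]. *)
Lemma few_small_classes (gT : finGroupType) (H : {group gT}) (p : nat) :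
  prime p -> p.-group H -> H^`(1) \subset 'Z(H) -> #|H^`(1)| = (p ^ 2)%N ->
  #|[set x in H | #|x ^: H| <= p]| * ((p - 1) * p ^ 2) <= (p ^ 2 - 1) * #|H|.
Proof.
move=> p_pr pH H2 cardH'; have p_gt1 := prime_gt1 p_pr; have p_gt0 := prime_gt0 p_pr.
set S := [set x in H | _].
pose T := [set m in H^`(1) | #[m] == p].
have nm m : m \in T -> <[m]> <| H.
  rewrite inE => /andP[H'm _]; apply: sub_center_normal.
  by rewrite cycle_subG (subsetP H2).
have le1 x : x \in S -> p - 1 <= \sum_(m in T | x \in relcenter H <[m]>) 1.
  rewrite inE => /andP[Hx lex].
  have sDH' := comm1_sub Hx.
  have [m0 [H'm0 om0 sD]] : exists m0,
      [/\ m0 \in H^`(1), #[m0] = p & [~: [set x], H] \subset <[m0]>].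
    have pD : p.-group [~: [set x], H].
      by rewrite (pgroupS _ pH) // (subset_trans sDH') ?der_sub.
    have [k cD] := p_natP pD; rewrite -(card_comm1 H2 Hx) cD in lex.
    case: k cD lex => [|[|k]] cD lex.
    (* Here [[x, H]] is trivial, and any subgroup of order [p] in H' can serve as [<[m0]>]. *)
    - have pdv : p %| #|H^`(1)| by rewrite cardH' dvdn_exp.
      have [m0 H'm0 om0] := Cauchy p_pr pdv.
      exists m0; split=> //; suff -> : [~: [set x], H] = 1 by apply: sub1G.
      exact: card1_trivg.
    - have /cyclicP[m0 /= Dm0] : cyclic [~: [set x], H].
        by apply: prime_cyclic; rewrite cD.
      exists m0; rewrite -Dm0 subxx; split=> //.
        by rewrite (subsetP sDH') // Dm0 cycle_id.
      by rewrite /order -Dm0 cD expn1.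
    - by move: lex; rewrite leqNgt -{1}(expn1 p) ltn_exp2l.
  apply: (@leq_trans #|<[m0]>^#|).
    by have := cardsD1 1 <[m0]>; rewrite group1 -[#|<[m0]>|]/#[m0] om0 => ->; rewrite add1n subn1.
  rewrite sum1dep_card; apply/subset_leq_card/subsetP=> m /setD1P[nm1 mm0].
  have om : #[m] = p.
    have: #[m] %| p by rewrite -om0 order_dvdG.
    by case/primeP: p_pr => _ H1 /H1 /orP[|/eqP//]; rewrite order_eq1 (negPf nm1).
  have Tm : m \in T.
    by rewrite inE om eqxx andbT; apply: subsetP mm0; rewrite cycle_subG.
  have E : <[m]> = <[m0]>.
    by apply/eqP; rewrite eqEcard cycle_subG mm0 -[#|<[m0]>|]/#[m0] -[#|<[m]>|]/#[m] om om0 leqnn.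
  by rewrite inE Tm mem_relcenter ?nm //= E.
have le2 m : m \in T -> (\sum_(x in S | x \in relcenter H <[m]>) 1) * p ^ 2 <= #|H|.
  move=> Tm; have nmH := nm m Tm; have sRH := relcenter_sub nmH.
  apply: (@leq_trans (#|relcenter H <[m]>| * p ^ 2)).
    rewrite leq_pmul2r ?expn_gt0 ?p_gt0 // sum1dep_card; apply/subset_leq_card.
    by apply/subsetP=> x; rewrite inE => /andP[].
  rewrite -(Lagrange sRH) leq_pmul2l ?cardG_gt0 //.
  have [|] := andP (index_relcenter_not_prime p_pr nmH _).
    apply/negP => /subset_leq_card; rewrite cardH' -[#|<[m]>|]/#[m].
    by move: Tm; rewrite inE => /andP[_ /eqP->]; rewrite leqNgt -{1}(expn1 p) ltn_exp2l.
  have [k ->] := pgroup_index_pfactor p_pr pH sRH.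
  case: k => [|[|k]]; rewrite ?eqxx ?expn1 ?eqxx // => _ _.
  by rewrite leq_exp2l.
have cardT : #|T| <= p ^ 2 - 1.
  rewrite -cardH' (cardsD1 1 H^`(1)) group1 add1n subn1 /=.
  apply/subset_leq_card/subsetP=> m; rewrite !inE => /andP[-> /eqP om].
  by rewrite andbT; apply: contraTneq p_gt1 => m1; rewrite -om m1 order1.
have: #|S| * (p - 1) <= \sum_(m in T) \sum_(x in S | x \in relcenter H <[m]>) 1.
  rewrite (exchange_big_dep (mem S)) => [|m x _ /andP[]] //=.
  rewrite -sum_nat_const; apply: leq_sum => x Sx; apply: leq_trans (le1 x Sx) _.
  by apply: eq_leq; apply: eq_bigl => m; rewrite Sx.
move=> le3; rewrite mulnA; apply: leq_trans (leq_mul le3 (leqnn _)) _.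
rewrite big_distrl /=; apply: (@leq_trans (\sum_(m in T) #|H|)).
  exact: leq_sum.
by rewrite sum_nat_const leq_mul2r cardT orbT.
Qed.

(** Both sides count the commuting pairs in [A x B]. *)
Lemma sum_cent1_swap (gT : finGroupType) (A B : {group gT}) :
  \sum_(u in A) #|'C_B[u]| = \sum_(x in B) #|'C_A[x]|.
Proof.
transitivity (\sum_(u in A) \sum_(x in B | x \in 'C[u]) 1).
  apply: eq_bigr => u _; rewrite sum1dep_card; apply: eq_card => x.
  by apply/setIP/idP=> [[Bx cx]|]; rewrite inE ?Bx // => /andP.
rewrite (exchange_big_dep (mem B)) => [|u x _ /andP[]] //=.
apply: eq_bigr => x Bx; rewrite sum1dep_card; apply: eq_card => u.
apply/idP/setIP=> [|[Au cu]]; rewrite inE Bx ?Au /= cent1C //.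
by case/andP.
Qed.

(** * Commuting pairs in G' x G *)

Section NotClassThree.
Variables (gT : finGroupType) (G : {group gT}) (p : nat).
Hypotheses (p_pr : prime p) (p_gt2 : 2 < p) (pG : p.-group G).
Hypothesis classG : forall x, x \in G -> x \notin 'Z(G) -> #|x ^: G| = (p ^ 3)%N.

Let Z2 := relcenter G 'Z(G).
Let nZG : 'Z(G) <| G. Proof. exact: center_normal. Qed.
Let sZ2G : Z2 \subset G. Proof. exact: relcenter_sub. Qed.

Let p_gt0 : 0 < p. Proof. exact: prime_gt0. Qed.
Let p_gt1 : 1 < p. Proof. exact: prime_gt1. Qed.

(** One inclusion comes from the equal class sizes, the other from the three subgroups lemma. *)
Let cent_der1 : 'C_G(G^`(1)) = Z2.
Proof.
apply/eqP; rewrite eqEsubset; apply/andP; split.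
  apply/subsetP=> x Cx; have [Gx _] := setIP Cx.
  by rewrite mem_relcenter //; apply: (cent_der1_sub_ucn2 classG pG).
rewrite subsetI sZ2G /=; apply/commG1P; rewrite commGC.
have Z2GG : [~: Z2, G, G] = 1.
  apply/commG1P; rewrite (subset_trans (_ : _ \subset 'Z(G))) ?subsetIr //.
  rewrite gen_subG; apply/subsetP=> _ /imset2P[x g Z2x Gg ->].
  by have [_ ->] := relcenterP x nZG Z2x.
by rewrite (three_subgroup _ Z2GG) // (commGC G).
Qed.

(** The preimage [N] of the centraliser of [x] modulo the centre contains [C_G(x)], and also G'
    because [[G', G]] is central. Hence the index of the centraliser of [x] in G' is at most
    [|N : C_G(x)|], while [|G : N|] is the size of the class of [x] modulo the centre. *)
Lemma cent1_der1_index_mul x : x \in G -> x \notin Z2 ->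
  #|G^`(1) : 'C_(G^`(1))[x]| * #|coset 'Z(G) x ^: (G / 'Z(G))| <= p ^ 3.
Proof.
move=> Gx nZ2x; have nZx : x \notin 'Z(G).
  apply: contra nZ2x => /centerP[_ cx]; apply/relcenterP=> //; split=> // g Gg.
  by have /commgP/eqP-> := cx g Gg; apply: group1.
pose N := (coset 'Z(G) @*^-1 'C_(G / 'Z(G))[coset 'Z(G) x])%G.
have sNG : N \subset G by rewrite sub_cosetpre_quo // subsetIl.
have iN : #|coset 'Z(G) x ^: (G / 'Z(G))| = #|G : N|.
  by rewrite -index_cent1 -index_cosetpre quotientGK.
have nZ := subsetP (normal_norm nZG).
have memN g : g \in G -> (g \in N) = ([~ x, g] \in 'Z(G)).
  move=> Gg; have E : ([~ coset 'Z(G) x, coset 'Z(G) g] == 1) = ([~ x, g] \in 'Z(G)).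
    rewrite -morphR ?nZ //; apply/eqP/idP=> [|/coset_id //].
    by apply: coset_idr; rewrite groupR ?nZ.
  rewrite -E; apply/morphpreP/commgP=> [[_ /setIP[_ /cent1P]] //|cxg].
  split; first exact: nZ.
  by apply/setIP; split; [apply: mem_quotient | apply/cent1P].
have GC := card_cent1_noncentral classG Gx nZx.
rewrite iN -(leq_pmul2r (cardG_gt0 'C_G[x])) [X in _ <= X]mulnC GC.
rewrite -(Lagrange sNG) mulnAC leq_pmul2r //.
rewrite -(leq_pmul2r (cardG_gt0 'C_(G^`(1))[x])) mulnAC [X in (X * _)%N]mulnC.
rewrite Lagrange ?subsetIl //.
have CE : G^`(1) :&: 'C_G[x] = 'C_(G^`(1))[x].
  by rewrite setIA (setIidPl (der_sub 1 G)).
have := mul_cardG (G^`(1))%G 'C_G[x]%G; rewrite /= CE => ->.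
rewrite leq_pmul2r ?cardG_gt0 //; apply/subset_leq_card.
have [abG' cG'] := der1_abelian_comm_central classG pG.
rewrite mul_subG //; apply/subsetP=> g.
  move=> G'g; rewrite memN ?(subsetP (der_sub 1 G)) //.
  by rewrite -groupV invg_comm (subsetP cG') // mem_commg.
by case/setIP=> Gg /cent1P/commute_sym/commgP/eqP cxg; rewrite memN // cxg group1.
Qed.

Let cardI x : (#|G^`(1) : 'C_(G^`(1))[x]| * #|'C_(G^`(1))[x]|)%N = #|G^`(1)|.
Proof. by rewrite mulnC Lagrange ?subsetIl. Qed.

Let qclass_pow x : exists k, #|coset 'Z(G) x ^: (G / 'Z(G))| = (p ^ k)%N.
Proof.
rewrite -index_cent1; apply: pgroup_index_pfactor; rewrite ?quotient_pgroup //.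
exact: subsetIl.
Qed.

(** Elements of [Z2] centralise G'. For the others the class modulo the centre has at least [p]
    elements and uses up one factor of [p^3]. *)
Lemma cent1_der1_bound x : x \in G -> 
  #|G^`(1)| <= p ^ 2 * #|'C_(G^`(1))[x]|.
Proof.
move=> Gx; case Z2x: (x \in Z2).
  have -> : 'C_(G^`(1))[x] = G^`(1).
    apply/setIidPl; rewrite sub_cent1.
    by move: Z2x; rewrite -cent_der1 => /setIP[].
  by rewrite leq_pmull // expn_gt0 p_gt0.
have := cent1_der1_index_mul Gx (negbT Z2x).
have [k kE] := qclass_pow x; rewrite kE -(cardI x) leq_pmul2r ?cardG_gt0 //.
case: k kE => [|k] kE; last first.
  rewrite expnS mulnCA expnS leq_pmul2l // => /(leq_trans _); apply.
  by rewrite leq_pmulr // expn_gt0 p_gt0.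
case/negP: (negbT Z2x); apply/relcenterP => //; split=> // g Gg.
have nZ := subsetP (normal_norm nZG).
apply: coset_idr; first by rewrite groupR ?nZ.
rewrite morphR ?nZ //; apply/eqP/commgP/cent1P.
move/eqP: kE; rewrite expn0 -index_cent1 indexg_eq1 => /subsetP/(_ (coset _ g)).
by case/(_ (mem_quotient _ Gg))/setIP=> _; rewrite cent1C.
Qed.

Lemma cent1_der1_bound_large x : x \in G -> p < #|coset 'Z(G) x ^: (G / 'Z(G))| ->
  #|G^`(1)| <= p * #|'C_(G^`(1))[x]|.
Proof.
move=> Gx lt_p; have nZ2x : x \notin Z2.
  move: lt_p; apply: contraL => /(relcenterP _ nZG)[_ cx].
  rewrite -leqNgt -index_cent1; suff -> : 'C_(G / 'Z(G))[coset 'Z(G) x] = G / 'Z(G).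
    by rewrite indexgg ltnW.
  apply/setIidPl; apply/subsetP=> _ /morphimP[g Ng Gg ->]; apply/cent1P/commute_sym/commgP.
  have nZ := subsetP (normal_norm nZG).
  by rewrite -morphR ?nZ //; apply/eqP; apply: coset_id; apply: cx.
have := cent1_der1_index_mul Gx nZ2x; rewrite -(cardI x) leq_pmul2r ?cardG_gt0 //.
have [k kE] := qclass_pow x; rewrite kE in lt_p *.
case: k lt_p {kE} => [|[|k]]; rewrite ?expn0 ?expn1 ?ltnn //.
  by rewrite ltnNge p_gt0.
move=> _; rewrite !expnS !(mulnCA _ p) !leq_pmul2l // expn0 muln1 => /(leq_trans _); apply.
by rewrite leq_pmulr // expn_gt0 p_gt0.
Qed.

Let Y := (G^`(1) :&: 'Z(G))%G.
(** The number of commuting pairs in G' x G: known exactly by summing over G', where a centraliser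
    is [G] or has index [p^3], and bounded below by summing over [G]. *)
Let T := \sum_(u in G^`(1)) #|'C_G[u]|.

Let T_eq : (T * p ^ 3 + #|G| * #|Y| = #|G| * (#|Y| * p ^ 3 + #|G^`(1)|))%N.
Proof.
rewrite /T (big_setID 'Z(G)) /= (eq_bigr (fun _ => #|G|)); last first.
  move=> u /setIP[_ /setIP[_ cuG]]; suff -> : 'C_G[u] = G by [].
  by apply/setIidPl; rewrite sub_cent1.
rewrite sum_nat_const mulnDl big_distrl /=.
rewrite (eq_bigr (fun _ => #|G|)); last first.
  move=> u /setDP[G'u nZu].
  by have := card_cent1_noncentral classG (subsetP (der_sub 1 G) u G'u) nZu.
rewrite sum_nat_const -(cardsID 'Z(G) G^`(1)) /=.
rewrite -[#|G^`(1) :&: 'Z(G)|]/#|Y|; lia.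
Qed.

Lemma two_class_sizes_odd_class2 : G^`(1) \subset 'Z(G).
Proof.
apply: contraT => n2.
have sYG' : Y \subset G^`(1) by apply: subsetIl.
have [d dE] := pgroup_index_pfactor p_pr (pgroupS (der_sub 1 G) pG) sYG'.
have cG' : #|G^`(1)| = (#|Y| * p ^ d)%N by rewrite -dE Lagrange.
have Y_gt0 : 0 < #|Y| := cardG_gt0 Y; have G_gt0 := cardG_gt0 G.
have T_ge : #|G| * #|G^`(1)| <= p ^ 2 * T.
  rewrite /T sum_cent1_swap -sum_nat_const big_distrr /=.
  by apply: leq_sum => x; apply: cent1_der1_bound.
(* This fails for [d >= 3], but still holds for [d = 1] and [d = 2], which need arguments of their
   own. *)
have ineq : p * p ^ d + 1 <= p ^ 3 + p ^ d.
  rewrite -(leq_pmul2l Y_gt0) -(leq_pmul2l G_gt0).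
  move: T_eq (leq_mul (leqnn p) T_ge); rewrite cG' !expnS expn0 !muln1; lia.
have [d0|[d1|[d2|d3]]] : d = 0 \/ d = 1%N \/ d = 2 \/ 2 < d by lia.
- by case/negP: n2; move/eqP: dE; rewrite d0 expn0 indexg_eq1 subsetI subxx.
(* Case [d = 1]. Any noncentral [u] of G' generates G' together with [Y], so [C_G(u) = C_G(G') = Z2]
   has index [p^3]. But [Z2] is also the centre of [G] relative to [Y], which has index [p] in G',
   and there the index [p^3] is impossible. *)
- have [u G'u nZu] := subsetPn n2; have Gu := subsetP (der_sub 1 G) u G'u.
  have nYG : Y <| G by rewrite normalI ?der_normal.
  have Z2E : relcenter G Y = Z2.
    apply/val_inj/setP=> x /=; apply/idP/idP=> /relcenterP-/(_ _)[] // Gx cx.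
      by apply/relcenterP=> //; split=> // g /cx/setIP[].
    by apply/relcenterP=> //; split=> // g Gg; rewrite inE cx // mem_commg.
  have iG' : #|G^`(1) : Y| = p by rewrite dE d1 expn1.
  have /eqP[] := index_relcenter_der1 p_pr nYG sYG' iG'.
  rewrite Z2E -(classG Gu nZu) -index_cent1; suff -> : 'C_G[u] = Z2 by [].
  rewrite -cent_der1; apply/eqP; rewrite eqEsubset; apply/andP; split; last first.
    by rewrite setIS // -cent_set1 centS // sub1set.
  apply/subsetP=> x /setIP[Gx cux]; rewrite inE Gx /= -sub_cent1.
  pose C := 'C_(G^`(1))[x]%G.
  have sCG' : C \subset G^`(1) by apply: subsetIl.
  have sYC : Y \subset C.
    rewrite subsetI sYG' sub_cent1; apply/centP=> z /setIP[_ /centerP[_ cz]].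
    exact/commute_sym/cz.
  have: #|G^`(1) : C| %| p.
    by rewrite -[X in _ %| X]iG' -(Lagrange_index sCG' sYC) dvdn_mulr.
  case/primeP: (p_pr) => _ H1 /H1 /orP[|/eqP iC].
    by rewrite indexg_eq1 subsetI => /andP[].
  have YC : Y :=: C by apply: (subgroup_eq_index sYC sCG'); rewrite iC iG'.
  have : u \in C by rewrite inE G'u cent1C.
  by rewrite -YC inE (negPf nZu) andbF.
(* Case [d = 2]. The lower bound on commuting pairs is improved by a factor [p] outside the set [S]
   of elements whose class modulo the centre has at most [p] members; [S] itself is small. *)
- pose H := (G / 'Z(G))%G.
  have nZ : G \subset 'N('Z(G)) := normal_norm nZG.
  have cH' : #|H^`(1)| = (p ^ 2)%N.
    rewrite -quotient_der // card_quotient ?(subset_trans (der_sub 1 G)) //.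
    by rewrite -indexgI dE d2.
  have H2 : H^`(1) \subset 'Z(H).
    have [_ cG'G] := der1_abelian_comm_central classG pG.
    rewrite subsetI der_sub -quotient_der // quotient_cents2 //.
    exact: subset_trans (der_sub 1 G) nZ.
  have := @few_small_classes _ H p p_pr (quotient_pgroup _ pG) H2 cH'.
  set SH := [set x in _ | _] => leSH.
  pose S := [set x in G | coset 'Z(G) x \in SH].
  have cardS : #|S| <= #|SH| * #|'Z(G)|.
    rewrite -sum1_card (partition_big (coset 'Z(G)) (mem SH)) => [|x]; last first.
      by rewrite inE => /andP[].
    rewrite -sum_nat_const; apply: leq_sum => h /setIdP[/morphimP[y Ny Gy ->] _].
    rewrite sum1dep_card -(card_rcoset 'Z(G) y) -val_coset //.
    apply/subset_leq_card/subsetP=> x; rewrite inE => /andP[/setIdP[Gx _]].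
    move/eqP <-; rewrite val_coset ?rcoset_refl //; exact: subsetP nZ x Gx.
  (* Outside [S] an element commutes with at least [|G'| / p] elements of G', inside [S] with at
     least [|G'| / p^2]; the last term makes up the difference on [S]. *)
  have T_ge2 : #|G^`(1)| * (p * #|G|) <= p ^ 2 * T + #|G^`(1)| * ((p - 1) * #|S|).
    have -> : (#|G^`(1)| * ((p - 1) * #|S|) =
        \sum_(x in G) if x \in S then #|G^`(1)| * (p - 1) else 0)%N.
      rewrite -big_mkcondr mulnA mulnC -sum_nat_const; apply: eq_bigl => x.
      by rewrite inE; case: (x \in G).
    rewrite /T sum_cent1_swap big_distrr /= -big_split /= mulnA mulnC -sum_nat_const.
    apply: leq_sum => x Gx; rewrite !inE Gx mem_quotient //=.
    case: (leqP _ p) => [_|lt_p]; last first.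
      have leC := cent1_der1_bound_large Gx lt_p.
      by rewrite addn0 mulnC -mulnn -mulnA leq_pmul2l.
      have leC := cent1_der1_bound Gx.
      have -> : (#|G^`(1)| * p = #|G^`(1)| + #|G^`(1)| * (p - 1))%N.
        by rewrite -mulnS subn1 prednK.
      by rewrite leq_add2r.
  have cG : #|G| = (#|'Z(G)| * #|H|)%N.
    by rewrite card_quotient // Lagrange // center_sub.
  have leS : #|S| * ((p - 1) * p ^ 2) <= (p ^ 2 - 1) * #|G|.
    apply: leq_trans (leq_mul cardS (leqnn _)) _.
    have := leq_mul leSH (leqnn #|'Z(G)|); rewrite cG.
    by move: ((p - 1) * p ^ 2)%N (p ^ 2 - 1)%N => a b; lia.
  (* False for every odd [p], but true for [p = 2], where it reads [19 <= 20]. *)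
  have : p ^ 4 + p + 1 <= 2 * p ^ 3 + p ^ 2.
    rewrite -(leq_pmul2l Y_gt0) -(leq_pmul2l G_gt0).
    have eq2 : (p ^ 2 - 1 + 1 = p ^ 2)%N by rewrite subnK // expn_gt0 p_gt0.
    move: T_eq (leq_mul (leqnn p) T_ge2) (leq_mul (leqnn (#|Y| * p)) leS).
    move: (congr1 (muln (#|Y| * p * #|G|)) eq2); rewrite cG' d2.
    by move: (p ^ 2 - 1)%N (p - 1)%N => a b; rewrite !expnS expn0; lia.
  have : 3 * p ^ 3 <= p ^ 4 by rewrite expnS leq_mul.
  have : 3 * p ^ 2 <= p ^ 3 by rewrite [X in _ <= X]expnS leq_mul.
  by lia.
- have : p ^ 3 <= p ^ d by rewrite leq_exp2l.
  have := leq_mul p_gt1 (leqnn (p ^ d)); lia.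
Qed.

End NotClassThree.

(** * Groups of class two with classes of size p^3 *)

Section ClassTwoStructure.
Variables (gT : finGroupType) (G : {group gT}) (p : nat).
Hypotheses (p_pr : prime p) (p_gt2 : 2 < p) (pG : p.-group G).
Hypothesis classG : forall x, x \in G -> x \notin 'Z(G) -> #|x ^: G| = (p ^ 3)%N.
Hypothesis G2 : G^`(1) \subset 'Z(G).

Local Notation D x := [~: [set x], G].
Let p_gt0 : 0 < p. Proof. exact: prime_gt0. Qed.
Let p_gt1 : 1 < p. Proof. exact: prime_gt1. Qed.

Let cardD x : x \in G -> x \notin 'Z(G) -> #|D x| = (p ^ 3)%N.
Proof. by move=> Gx nZx; rewrite (card_comm1 G2 Gx) classG. Qed.

Let memD x g : x \in G -> g \in G -> [~ x, g] \in D x.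
Proof. by move=> Gx Gg; apply: mem_commg; rewrite ?set11. Qed.

(** Taking [p]-th powers maps [D x] onto [D (x ^+ p)]. If [x ^+ p] were noncentral, both would have
    order [p^3] and the power map would be injective on a group that contains an element of order
    [p]. *)
Lemma expg_prime_central x : x \in G -> x ^+ p \in 'Z(G).
Proof.
move=> Gx; apply: contraT => nZxp; have Gxp : x ^+ p \in G by rewrite groupX.
have nZx : x \notin 'Z(G) by apply: contra nZxp => Zx; rewrite groupX.
have imE : D (x ^+ p) = [set d ^+ p | d in D x].
  rewrite !(comm1E G2) // -imset_comp; apply: eq_in_imset => g Gg /=.
  by rewrite (class2_commXg G2).
have /imset_injP injp : #|[set d ^+ p | d in D x]| == #|D x| by rewrite -imE !cardD.
have pdv : p %| #|D x| by rewrite cardD // dvdn_exp.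
have [d Dd od] := Cauchy p_pr pdv.
have d1 : d = 1 by apply: injp; rewrite ?group1 // -od expg_order expg1n.
by move: p_gt1; rewrite -od d1 order1.
Qed.

Lemma abelem_quotient_center : p.-abelem (G / 'Z(G)).
Proof.
have nZ := subsetP (normal_norm (center_normal G)).
apply/abelemP=> //; split; first exact: sub_der1_abelian.
move=> _ /morphimP[x Nx Gx ->]; rewrite -morphX //; apply: coset_id.
exact: expg_prime_central.
Qed.

Lemma abelem_der1 : p.-abelem G^`(1).
Proof.
have abG' : abelian G^`(1) := abelianS G2 (center_abelian G).
apply/abelemP=> //; split=> // d.
suff /subsetP sub : G^`(1) \subset Group (group_Ldiv p abG') by move/sub/LdivP=> [].
rewrite gen_subG; apply/subsetP=> _ /imset2P[x y Gx Gy ->].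
apply/LdivP; split; first exact: mem_commg.
rewrite -(class2_commXg G2) //; apply/eqP/commgP.
by have /centerP[_ cx] := expg_prime_central Gx; apply: cx.
Qed.

Let expD x g : x \in G -> g \in G -> [~ x, g] ^+ p = 1.
Proof.
move=> Gx Gg; have /abelemP[//|_] := abelem_der1; apply; exact: mem_commg.
Qed.

Lemma comm1_preim w (E : {group gT}) : w \in G -> E \subset D w ->
  exists N : {group gT}, [/\ N \subset G, #|G : N| = #|D w : E|
    & forall g, g \in G -> (g \in N) = ([~ w, g] \in E)].
Proof.
move=> Gw sED; have fM : {in G &, {morph (fun g => [~ w, g]) : a b / a * b}}.
  by move=> a b Ga Gb; rewrite /= (class2_commgM G2).
pose f := Morphism fM; have fG : f @* G = D w by rewrite (comm1E G2) // morphimEdom.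
exists (f @*^-1 E)%G; split; first exact: subsetIl.
  rewrite -fG -(index_morphpre (f := f) (L := (f @* G)%G)) //.
  suff -> : f @*^-1 (f @* G)%G = G by [].
  by apply/eqP; rewrite eqEsubset subsetIl -sub_morphim_pre /=.
by move=> g Gg; rewrite !inE Gg.
Qed.

(** Suppose [e4 = [y, z]] lies outside [D x], and let [E] be generated by [e1 = [x, y]] and [e4].
    Since [z] commutes with [x], the group [E] of order [p^2] lies in [D (x^k y)] for every [k], so
    the [g] with [[x^k y, g]] in [E] form a subgroup of index [p]. The subgroups for [k = 1] and
    [k = 2] differ and so generate [G]; on each of them [[x, g]] is forced into [D y]. Then
    [D x = D y] contains [e4]. *)
Lemma comm1_noncommuting x y z : x \in G -> y \in G -> y \notin 'C[x] -> z \in 'C_G[x] ->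
  [~ y, z] \in D x.
Proof.
move=> Gx Gy nCxy /setIP[Gz Cxz]; apply: contraT => nDx.
have noncentral w v : v \in G -> [~ w, v] != 1 -> w \notin 'Z(G).
  by move=> Gv; apply: contra => /centerP[_ cw]; apply/commgP/cw.
have xz1 : [~ x, z] = 1 by apply/eqP/commgP/commute_sym/cent1P.
have xy1 : [~ x, y] != 1.
  by apply: contra nCxy => /commgP/commute_sym cxy; apply/cent1P.
have yz1 : [~ y, z] != 1 by apply: contraNneq nDx => ->; apply: group1.
have nZx : x \notin 'Z(G) by apply: noncentral xy1.
have nZy : y \notin 'Z(G) by apply: noncentral yz1.
have comm_order g h : g \in G -> h \in G -> [~ g, h] != 1 -> #[[~ g, h]] = p.
  by move=> Gg Gh; apply: nt_prime_order => //; apply: expD.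
set e1 := [~ x, y] in xy1; set e4 := [~ y, z] in yz1 nDx.
have Dx1 : e1 \in D x by apply: memD.
have cE : <[e4]> \subset 'C(<[e1]>).
  apply: cents_cycle.
  by apply: (class2_central G2) => //; apply: groupR.
pose E := (<[e1]> <*> <[e4]>)%G.
have TIe : <[e4]> :&: <[e1]> = 1.
  apply: prime_TIg; first by rewrite -[#|_|]/#[e4] comm_order.
  by apply: contra nDx; rewrite cycle_subG; apply: subsetP; rewrite cycle_subG.
have cardE : #|E| = (p ^ 2)%N.
  rewrite /= cent_joinEr // TI_cardMg 1?setIC //.
  by rewrite -[#|<[e1]>|]/#[e1] -[#|<[e4]>|]/#[e4] !comm_order.
have Ee1 : e1 \in E by rewrite mem_gen // inE cycle_id.
have Ee4 : e4 \in E by rewrite mem_gen // inE cycle_id orbT.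
have sED w : w \in G -> [~ w, x] = e1^-1 -> [~ w, z] = e4 -> E \subset D w.
  move=> Gw wx wz; rewrite join_subG !cycle_subG -{1}(invgK e1) -wx -wz groupV.
  by rewrite !memD.
have yx : [~ y, x] = e1^-1 by rewrite invg_comm.
have sEDk k : E \subset D (x ^+ k * y).
  have Gxk : x ^+ k \in G by rewrite groupX.
  apply: sED; rewrite ?groupM // (class2_commMg G2) // (class2_commXg G2) //.
    by rewrite commgg expg1n mul1g.
  by rewrite xz1 expg1n mul1g.
have nZk k : x ^+ k * y \notin 'Z(G).
  apply: (@noncentral _ z) => //; rewrite (class2_commMg G2) ?groupX //.
  by rewrite (class2_commXg G2) // xz1 expg1n mul1g.
have preim k : exists N : {group gT}, [/\ N \subset G, #|G : N| = p
    & forall g, g \in G -> (g \in N) = ([~ x, g] ^+ k * [~ y, g] \in E)].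
  have Gw : x ^+ k * y \in G by rewrite groupM ?groupX.
  have [N [sNG iN memN]] := comm1_preim Gw (sEDk k); exists N; split=> //.
    rewrite iN; apply/eqP; rewrite -(eqn_pmul2l (cardG_gt0 E)) (Lagrange (sEDk k)).
    by rewrite cardE cardD // -expnSr.
  by move=> g Gg; rewrite memN // (class2_commMg G2) ?groupX // (class2_commXg G2).
have [N1 [sN1 iN1 memN1]] := preim 1%N; have [N2 [sN2 iN2 memN2]] := preim 2.
have sEDy : E \subset D y by have := sEDk 0; rewrite expg0 mul1g.
(* If [N2] were inside [N1], then on [N2] the commutator [[x, g]] would be a quotient of two
   elements of [E]. So the part of [E] inside [D x] would have order at least [p^2], which is all of
   [E], including [e4]. *)
have neN : ~~ (N2 \subset N1).
  apply: contra nDx => sN21; pose F := (E :&: D x)%G.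
  have sFDx : F \subset D x by apply: subsetIr.
  have [N [sNG iN memN]] := comm1_preim Gx sFDx.
  have sN2N : N2 \subset N.
    apply/subsetP=> g N2g; have Gg := subsetP sN2 g N2g.
    have := subsetP sN21 g N2g; rewrite memN1 // memN // inE memD // andbT expg1.
    move: N2g; rewrite memN2 // expg2 -mulgA => E2 E1.
    by rewrite groupMr in E2.
  have : #|D x : F| <= p by rewrite -iN -iN2 dvdn_leq // indexgS.
  rewrite -(leq_pmul2l (cardG_gt0 F)) Lagrange // cardD // expnSr leq_pmul2r //.
  rewrite -cardE => leEF; have /setIidPl : E :&: D x = E.
    by apply/eqP; rewrite eqEcard subsetIl.
  by move/subsetP; apply.
have maxN1 : maximal N1 G by apply: p_index_maximal; rewrite ?iN1.
have GE : N1 * N2 = G.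
  by apply: mulg_normal_maximal neN => //; apply: p_maximal_normal pG maxN1.
have sDxDy : D x \subset D y.
  apply/subsetP=> _ /(comm1P G2 _ Gx)[g Gg ->].
  have /mulsgP[g1 g2 Ng1 Ng2 ->] : g \in N1 * N2 by rewrite GE.
  have Gg1 := subsetP sN1 g1 Ng1; have Gg2 := subsetP sN2 g2 Ng2.
  rewrite (class2_commgM G2) // groupM //.
    move: Ng1; rewrite memN1 // expg1 => /(subsetP sEDy).
    by rewrite groupMr // memD.
  move: Ng2; rewrite memN2 // => /(subsetP sEDy); rewrite groupMr ?memD // => D2.
  (* On [N2] only the square of [[x, g2]] is seen to lie in [D y]; the exponent [p.+1./2] is the
     inverse of 2 modulo [p]. *)
  have -> : [~ x, g2] = ([~ x, g2] ^+ 2) ^+ (p.+1./2).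
    have op : odd p by case: (even_prime p_pr) p_gt2 => [->|].
    rewrite -expgM mul2n even_halfK ?oddS ?op //.
    by rewrite expgS expD // mulg1.
  by rewrite groupX.
case/negP: nDx; have -> : D x = D y by apply/eqP; rewrite eqEcard sDxDy !cardD //=.
by rewrite memD.
Qed.

(** An element [y] of [C_G(x)] is the quotient of [y0 * y] and [y0], both outside [C_G(x)], where
    the preceding lemma applies. *)
Lemma comm1_cent1_sub x z : x \in G -> x \notin 'Z(G) -> z \in 'C_G[x] ->
  D z \subset D x.
Proof.
move=> Gx nZx Cz; have [Gz _] := setIP Cz.
have [y0 Gy0 nCy0] : exists2 y, y \in G & y \notin 'C[x].
  by apply/subsetPn; apply: contra nZx; rewrite sub_cent1 => cGx; rewrite inE Gx.
have nC y : y \in G -> y \notin 'C[x] -> [~ z, y] \in D x.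
  by move=> Gy nCy; rewrite -groupV invg_comm comm1_noncommuting.
apply/subsetP=> _ /(comm1P G2 _ Gz)[y Gy ->].
case: (boolP (y \in 'C[x])) => [Cy|]; last exact: nC.
have nCy : y0 * y \notin 'C[x] by rewrite groupMr.
have := nC (y0 * y) (groupM Gy0 Gy) nCy.
by rewrite (class2_commgM G2) // groupMl // nC.
Qed.

Lemma index_mul_leq (A B R : {group gT}) : A :&: B = 'Z(G) -> 'Z(G) \subset R ->
  A \subset R -> B \subset R -> #|A : 'Z(G)| * #|B : 'Z(G)| <= #|R : 'Z(G)|.
Proof.
move=> ABZ sZR sAR sBR; have Z_gt0 := cardG_gt0 'Z(G).
have sZA : 'Z(G) \subset A by rewrite -ABZ subsetIl.
have sZB : 'Z(G) \subset B by rewrite -ABZ subsetIr.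
rewrite -(leq_pmul2r Z_gt0) -(leq_pmul2r Z_gt0).
have -> : (#|A : 'Z(G)| * #|B : 'Z(G)| * #|'Z(G)| * #|'Z(G)| = #|A| * #|B|)%N.
  rewrite -mulnA mulnACA mulnC [X in (X * _)%N]mulnC Lagrange //.
  by rewrite mulnC [X in (X * _)%N]mulnC Lagrange.
have := mul_cardG A B; rewrite ABZ => ->; rewrite leq_pmul2r //.
by rewrite [X in _ <= X]mulnC Lagrange // subset_leq_card // mul_subG.
Qed.

(** The blocks [V x] have codimension at most 3 modulo the centre, and they are proper because
    [|G'| > p^3]. Two distinct blocks, of dimensions [a] and [b], meet in the centre, so
    [a + b <= v] with [a, b >= v - 3], which leaves [v] equal to 4, 5 or 6. *)
Lemma card_quotient_center_p4 : p ^ 3 < #|G^`(1)| -> #|G : 'Z(G)| = (p ^ 4)%N.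
Proof.
move=> ltG'.
pose V x := relcenter G (D x).
have nD x : x \in G -> D x <| G.
  by move=> Gx; apply: sub_center_normal; apply: subset_trans (comm1_sub Gx) G2.
have sVG x : x \in G -> V x \subset G by move=> Gx; apply: relcenter_sub (nD x Gx).
have memV x y : x \in G -> y \in G -> (y \in V x) = (D y \subset D x).
  by move=> Gx Gy; rewrite mem_relcenter // nD.
have sCV x : x \in G -> x \notin 'Z(G) -> 'C_G[x] \subset V x.
  move=> Gx nZx; apply/subsetP=> z Cz; have [Gz _] := setIP Cz.
  by rewrite memV // comm1_cent1_sub.
have sZC x : x \in G -> 'Z(G) \subset 'C_G[x].
  by move=> Gx; rewrite setIS // -cent_set1 centS // sub1set.
have sZV x : x \in G -> x \notin 'Z(G) -> 'Z(G) \subset V x.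
  by move=> Gx nZx; apply: subset_trans (sZC x Gx) (sCV x Gx nZx).
have Deq x y : x \in G -> x \notin 'Z(G) -> y \in V x -> y \notin 'Z(G) -> D y = D x.
  move=> Gx nZx Vy nZy; have Gy := subsetP (sVG x Gx) y Vy.
  by apply/eqP; rewrite eqEcard -memV // Vy !cardD //=.
have Vself x : x \in G -> x \in V x by move=> Gx; rewrite memV.
have VI x y : x \in G -> x \notin 'Z(G) -> y \in G -> y \notin V x -> V x :&: V y = 'Z(G).
  move=> Gx nZx Gy nVy.
  have nZy : y \notin 'Z(G) by apply: contra nVy => /(subsetP (sZV x Gx nZx)).
  apply/eqP; rewrite eqEsubset; apply/andP; split; last by rewrite subsetI !sZV.
  apply/subsetP=> z /setIP[Vxz Vyz].
  apply: contraT => nZz; case/negP: nVy.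
  by rewrite memV // -(Deq x z) // (Deq y z).
have VneG x : x \in G -> x \notin 'Z(G) -> ~~ (G \subset V x).
  move=> Gx nZx; apply/negP=> sGV; move: ltG'; rewrite ltnNge -(cardD Gx nZx) => /negP[].
  apply/subset_leq_card; rewrite gen_subG; apply/subsetP=> _ /imset2P[g h Gg Gh ->].
  by have /(relcenterP _ (nD x Gx))[_ ->] := subsetP sGV g Gg.
have sZG : 'Z(G) \subset G := center_sub G.
have idx (A : {group gT}) : 'Z(G) \subset A -> A \subset G -> exists a, #|A : 'Z(G)| = (p ^ a)%N.
  by move=> sZA sAG; apply: pgroup_index_pfactor => //; apply: pgroupS pG.
have [v vE] := idx G sZG (subxx G).
have idxV x : x \in G -> x \notin 'Z(G) ->
    exists a, [/\ #|V x : 'Z(G)| = (p ^ a)%N, v <= a + 3 & 3 < v].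
  move=> Gx nZx; have [a aE] := idx (V x) (sZV x Gx nZx) (sVG x Gx).
  have [c cE] := idx 'C_G[x]%G (sZC x Gx) (subsetIl _ _).
  have vc : v = (3 + c)%N.
    apply/eqP; rewrite -(eqn_exp2l _ _ p_gt1) -vE expnD -cE -(classG Gx nZx) -index_cent1.
    by rewrite Lagrange_index ?subsetIl ?sZC.
  have ca : c <= a.
    rewrite -(leq_exp2l _ _ p_gt1) -cE -aE.
    by rewrite dvdn_leq // indexSg ?sCV ?sZC.
  have c_gt0 : 0 < c.
    rewrite lt0n; apply: contra nZx => /eqP c0; move/eqP: cE.
    rewrite c0 expn0 indexg_eq1 => /subsetP; apply.
    by rewrite inE Gx cent1id.
  by exists a; split=> //; move: vc ca c_gt0; clear; lia.
have [x Gx nZx] : exists2 x, x \in G & x \notin 'Z(G).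
  apply/subsetPn; apply: contraL ltG' => sGZ; rewrite -leqNgt.
  have /eqP -> : G^`(1) == 1 by apply/eqP/commG1P/(subset_trans sGZ)/subsetIr.
  by rewrite cards1 expn_gt0 p_gt0.
have [y Gy nVy] := subsetPn (VneG x Gx nZx).
have nZy : y \notin 'Z(G) by apply: contra nVy => /(subsetP (sZV x Gx nZx)).
have VxyI := VI x y Gx nZx Gy nVy.
have [a [aE va v_gt3]] := idxV x Gx nZx.
have [b [bE vb _]] := idxV y Gy nZy.
have abv : a + b <= v.
  rewrite -(leq_exp2l _ _ p_gt1) expnD -aE -bE -vE.
  by apply: index_mul_leq => //; apply: sVG.
have [v4|[v5|v6]] : v = 4 \/ v = 5 \/ v = 6.
  by move: va vb abv v_gt3; clear; lia.
- by rewrite vE v4.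
(* Case [v = 5]: some block has dimension 2. For a maximal subgroup [M] of G' above [D w], the
   subgroup [R] is a union of blocks, and its codimension cannot be 0, 1 or 3. So [R] has dimension
   3, too small for two blocks of dimension at least 2 that meet trivially. *)
- have no2 w : w \in G -> w \notin 'Z(G) -> #|V w : 'Z(G)| = (p ^ 2)%N -> false.
    move=> Gw nZw wE; have sDG' := comm1_sub Gw.
    have [DG'|[M maxM sDM]] := maximal_exists sDG'.
      by move: ltG'; rewrite -DG' /= cardD // ltnn.
    have sMG' : M \subset G^`(1) := proper_sub (maxgroupp maxM).
    have nMG : M <| G by apply: sub_center_normal; apply: subset_trans sMG' G2.
    have iM : #|G^`(1) : M| = p.
      by apply: p_maximal_index maxM; apply: pgroupS pG; apply: der_sub.
    pose R := relcenter G M; have sRG : R \subset G by apply: relcenter_sub.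
    have sVR u : u \in R -> V u \subset R.
      move=> Ru; have Gu := subsetP sRG u Ru; apply/subsetP=> z Vz.
      have Gz := subsetP (sVG u Gu) z Vz; move: Vz Ru; rewrite memV // !mem_relcenter //.
      exact: subset_trans.
    have Rw : w \in R by rewrite mem_relcenter.
    have sZR : 'Z(G) \subset R := subset_trans (sZV w Gw nZw) (sVR w Rw).
    have [r rE] := idx R sZR sRG.
    have [k kE] := pgroup_index_pfactor p_pr pG sRG.
    have kr : (k + r = 5)%N.
      by apply/eqP; rewrite -(eqn_exp2l _ _ p_gt1) expnD -kE -rE Lagrange_index // vE v5.
    have r_ge2 : 1 < r.
      by rewrite -(leq_exp2l _ _ p_gt1) -wE -rE dvdn_leq // indexSg ?sVR ?sZV.
    have nG'M : ~~ (G^`(1) \subset M) by case/andP: (maxgroupp maxM).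
    have := index_relcenter_not_prime p_pr nMG nG'M; rewrite -/R kE => /andP[k0 k1].
    have := index_relcenter_der1 p_pr nMG sMG' iM; rewrite -/R kE => k3.
    have r3 : r = 3.
      have kN0 : k != 0 by apply: contraNneq k0 => ->.
      have kN1 : k != 1%N by apply: contraNneq k1 => ->; rewrite expn1.
      have kN3 : k != 3 by apply: contraNneq k3 => ->.
      by move: kr r_ge2 kN0 kN1 kN3; clear; lia.
    have [u Ru nVu] : exists2 u, u \in R & u \notin V w.
      apply/subsetPn/negP => sRV; have : #|R : 'Z(G)| <= #|V w : 'Z(G)|.
        by rewrite dvdn_leq // indexSg.
      by rewrite rE wE r3 leq_exp2l.
    have Gu := subsetP sRG u Ru.
    have nZu : u \notin 'Z(G) by apply: contra nVu => /(subsetP (sZV w Gw nZw)).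
    have [c [cE vc _]] := idxV u Gu nZu.
    have := index_mul_leq (VI w u Gw nZw Gu nVu) sZR (sVR w Rw) (sVR u Ru).
    by rewrite wE cE rE r3 -expnD leq_exp2l //; move: vc; rewrite v5; clear; lia.
  have [a2|b2] : a = 2 \/ b = 2.
    by move: va vb abv; rewrite v5; clear; lia.
    by have := no2 x Gx nZx; rewrite aE a2 => /(_ erefl).
  by have := no2 y Gy nZy; rewrite bE b2 => /(_ erefl).
(* Case [v = 6]: a block of dimension 3 equals the centraliser of each noncentral element in it,
   hence is abelian. As [G] is the product of two blocks, [D y] consists of commutators with [V x],
   which lie in [D x]. *)
have abV w : w \in G -> w \notin 'Z(G) -> #|V w : 'Z(G)| = (p ^ 3)%N -> abelian (V w).
  move=> Gw nZw wE; apply/subsetP=> u Vu; have Gu := subsetP (sVG w Gw) u Vu.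
  case Zu: (u \in 'Z(G)).
    by have [_] := setIP Zu; apply: subsetP; apply: centS; apply: sVG.
  have sCV' : 'C_G[u] \subset V w.
    apply: subset_trans (sCV u Gu (negbT Zu)) _; apply/subsetP=> z Vz.
    have Gz := subsetP (sVG u Gu) z Vz.
    by move: Vz; rewrite !memV // (Deq w u) ?Zu.
  have -> : V w :=: 'C_G[u].
    symmetry; apply: subgroup_eq_index sCV' (sVG w Gw) _.
    have := Lagrange_index (sVG w Gw) (sZV w Gw nZw).
    rewrite index_cent1 (classG Gu (negbT Zu)) wE vE v6 (expnD p 3 3) => /eqP.
    by rewrite eqn_pmul2r ?expn_gt0 ?p_gt0 // => /eqP ->.
  by rewrite -sub_cent1 subsetIr.
have [a3 b3] : a = 3 /\ b = 3.
  by move: va vb abv; rewrite v6; clear; lia.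
have GV : V x * V y = G.
  apply/eqP; rewrite eqEcard mul_subG ?sVG //=.
  have cVx : #|V x| = (#|'Z(G)| * p ^ 3)%N by rewrite -(Lagrange (sZV x Gx nZx)) aE a3.
  have cVy : #|V y| = (#|'Z(G)| * p ^ 3)%N by rewrite -(Lagrange (sZV y Gy nZy)) bE b3.
  have cG : #|G| = (#|'Z(G)| * (p ^ 3 * p ^ 3))%N by rewrite -(Lagrange sZG) vE v6 -expnD.
  have := mul_cardG (V x) (V y); rewrite VxyI cVx cVy cG => mE.
  by rewrite -(leq_pmul2r (cardG_gt0 'Z(G))) -mE mulnACA mulnAC.
case/negP: nVy; rewrite memV //; apply/subsetP=> _ /(comm1P G2 _ Gy)[g Gg ->].
have /mulsgP[g1 g2 Vg1 Vg2 ->] : g \in V x * V y by rewrite GV.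
have Gg1 := subsetP (sVG x Gx) g1 Vg1; have Gg2 := subsetP (sVG y Gy) g2 Vg2.
rewrite (class2_commgM G2) //.
have -> : [~ y, g2] = 1.
  apply/eqP/commgP; apply: (centsP (abV y Gy nZy _)) => //; last exact: Vself.
  by rewrite bE b3.
rewrite mulg1 -groupV invg_comm.
by apply: (subsetP (_ : D g1 \subset D x)); rewrite -?memV // memD.
Qed.

End ClassTwoStructure.

(** * Isoclinism and central extensions *)

Lemma isom_same_ker (dT aT bT : finGroupType) (D : {group dT}) (A : {group aT}) (B : {group bT})
    (q1 : {morphism D >-> aT}) (q2 : {morphism D >-> bT}) :
  'ker q1 = 'ker q2 -> q1 @* D = A -> q2 @* D = B ->
  exists theta : {morphism A >-> bT},
    isom A B theta /\ {in D, forall d, theta (q1 d) = q2 d}.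
Proof.
move=> kerq imA imB; have eA : A = (q1 @* D)%G by apply: val_inj; rewrite /= imA.
subst A; have sK : 'ker q1 \subset 'ker q2 by rewrite kerq.
exists (factm_morphism sK (subxx D)); split=> [|d Dd]; last exact: factmE.
apply/isomP; split; first by apply/injm_factmP.
by rewrite /= morphim_factm.
Qed.

Lemma isom_comp (aT bT cT : finGroupType) (A : {group aT}) (B : {group bT}) (C : {group cT})
    (f : {morphism A >-> bT}) (g : {morphism B >-> cT}) :
  isom A B f -> isom B C g ->
  exists h : {morphism A >-> cT}, isom A C h /\ {in A, h =1 g \o f}.
Proof.
move=> /isomP[injf imf] /isomP[injg img].
have fB a : a \in A -> f a \in B by move=> Aa; rewrite -imf mem_morphim.
have hM : {in A &, {morph g \o f : x y / x * y}}.
  by move=> x y Ax Ay /=; rewrite !morphM ?fB.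
exists (Morphism hM); split=> //; apply/isomP; split.
  apply/injmP=> x y Ax Ay /= gf; apply: (injmP injf) => //.
  by apply: (injmP injg); rewrite ?fB.
rewrite -img !morphimEdom; apply/setP=> c; apply/imsetP/imsetP=> [[a Aa ->]|[b Bb ->]].
  by exists (f a); rewrite ?fB.
have /morphimP[a _ Aa ->] : b \in f @* A by rewrite imf.
by exists a.
Qed.

Section IsoclinicCriterion.
Variables (gT hT aT dT : finGroupType) (G : {group gT}) (H : {group hT}) (D : {group dT}).
Variables (f1 : {morphism G >-> aT}) (f2 : {morphism H >-> aT}).
Variables (q1 : {morphism D >-> gT}) (q2 : {morphism D >-> hT}).
Variable kappa : aT -> aT -> dT.
Hypotheses (imf : f1 @* G = f2 @* H) (kerq : 'ker q1 = 'ker q2).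
Hypotheses (imq1 : q1 @* D = G^`(1)) (imq2 : q2 @* D = H^`(1)).
Hypothesis kerf1 : 'ker f1 = 'Z(G).
Hypothesis kappaD : forall x y, x \in G -> y \in G -> kappa (f1 x) (f1 y) \in D.
Hypothesis comm1 : forall x y, x \in G -> y \in G -> [~ x, y] = q1 (kappa (f1 x) (f1 y)).
Hypothesis comm2 : forall x y, x \in H -> y \in H -> [~ x, y] = q2 (kappa (f2 x) (f2 y)).

Let lift12 x : x \in H -> exists2 g, g \in G & f2 x = f1 g.
Proof.
move=> Hx; have : f2 x \in f1 @* G by rewrite imf mem_morphim.
by case/morphimP=> g _ Gg ->; exists g.
Qed.

Let lift21 g : g \in G -> exists2 x, x \in H & f1 g = f2 x.
Proof.
move=> Gg; have : f1 g \in f2 @* H by rewrite -imf mem_morphim.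
by case/morphimP=> x _ Hx ->; exists x.
Qed.

Let comm12 x y g h : x \in H -> y \in H -> g \in G -> h \in G ->
  f2 x = f1 g -> f2 y = f1 h -> ([~ x, y] == 1) = ([~ g, h] == 1).
Proof.
move=> Hx Hy Gg Gh fx fy; rewrite comm2 // comm1 // fx fy.
apply/eqP/eqP=> q0.
  have : kappa (f1 g) (f1 h) \in 'ker q2 by apply/kerP; rewrite ?kappaD.
  by rewrite -kerq => /kerP->; rewrite ?kappaD.
have : kappa (f1 g) (f1 h) \in 'ker q1 by apply/kerP; rewrite ?kappaD.
by rewrite kerq => /kerP->; rewrite ?kappaD.
Qed.

(** In either group an element is central when [kappa] pairs its image with everything into the
    kernel of [q1] or [q2]. These kernels agree, so the centre of [H] corresponds to that of [G]. *)
Let kerf2 : 'ker f2 = 'Z(H).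
Proof.
apply/setP=> x; apply/idP/idP=> [kx|/centerP[Hx cx]].
  have Hx := dom_ker kx; apply/centerP; split=> // y Hy; apply/commgP.
  have [h Gh fy] := lift12 Hy.
  by rewrite (comm12 Hx Hy (group1 G) Gh) ?morph1 ?(mker kx) // comm1g.
have [g Gg fx] := lift12 Hx; apply/kerP=> //; rewrite fx.
apply/mker; rewrite kerf1; apply/centerP; split=> // h Gh.
have [y Hy fy] := lift21 Gh; apply/commgP; rewrite -(comm12 Hx Hy Gg Gh) //.
by apply/commgP/cx.
Qed.

(** Both commutator maps are compared with one map [kappa] into a common group [D]. Letting [q1] and
    [q2] have a kernel allows [D] to be the exterior square when [H] is a quotient of [G_3]. *)
Lemma isoclinic_crit : isoclinic G H.
Proof.
have nZ (rT : finGroupType) (K : {group rT}) : K \subset 'N('Z(K)).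
  exact: normal_norm (center_normal K).
pose c1 := restrm (nZ _ G) (coset 'Z(G)); pose c2 := restrm (nZ _ H) (coset 'Z(H)).
have kc (rT : finGroupType) (K : {group rT}) : 'ker (restrm (nZ _ K) (coset 'Z(K))) = 'Z(K).
  by rewrite ker_restrm ker_coset; apply/setIidPr; apply: center_sub.
have [phi1 [iso1 phi1E]] : exists phi1 : {morphism G / 'Z(G) >-> aT},
    isom (G / 'Z(G)) (f1 @* G) phi1 /\ {in G, forall x, phi1 (coset 'Z(G) x) = f1 x}.
  apply: (isom_same_ker (q1 := [morphism of c1]) (q2 := f1)) => //.
    by rewrite kc kerf1.
  by rewrite morphim_restrm setIid.
have [phi2 [iso2 phi2E]] : exists phi2 : {morphism f1 @* G >-> coset_of 'Z(H)},
    isom (f1 @* G) (H / 'Z(H)) phi2 /\ {in H, forall x, phi2 (f2 x) = coset 'Z(H) x}.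
  apply: (isom_same_ker (q1 := f2) (q2 := [morphism of c2])) => //.
    by rewrite kc kerf2.
  by rewrite morphim_restrm setIid.
have [phi [iso phiE]] := isom_comp iso1 iso2.
have [theta [isot thetaE]] := isom_same_ker kerq imq1 imq2.
exists phi, theta; split=> // x y x' y' Gx Gy phix phiy.
have lift g h : g \in G -> h \in (phi (coset 'Z(G) g) : {set hT}) ->
    h \in H /\ f2 h = f1 g.
  move=> Gg; rewrite phiE ?mem_quotient //= phi1E //.
  have [h0 Hh0 fh0] := lift21 Gg; rewrite fh0 phi2E //.
  rewrite val_coset ?(subsetP (nZ _ H)) // => /rcosetP[z Zz ->].
  have Hz : z \in H by case/setIP: Zz.
  rewrite groupM // morphM // [f2 z](mker _) ?mul1g // kerf2 //.
have [Hx' fx'] := lift x x' Gx phix; have [Hy' fy'] := lift y y' Gy phiy.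
by rewrite comm1 // thetaE ?kappaD // comm2 // fx' fy'.
Qed.

End IsoclinicCriterion.

(** * Biadditive maps and the central extensions they define *)

Record biadd (V D : zmodType) := Biadd {
  biadd_fun :> V -> V -> D;
  biaddDl : forall u v w, biadd_fun (u + v)%R w = (biadd_fun u w + biadd_fun v w)%R;
  biaddDr : forall u v w, biadd_fun w (u + v)%R = (biadd_fun w u + biadd_fun w v)%R }.

Section BiaddTheory.
Import GRing.Theory.
Variables (V D : zmodType) (b : biadd V D).
Local Open Scope ring_scope.

Lemma biadd0l v : b 0 v = 0.
Proof. by apply: (addrI (b 0 v)); rewrite -biaddDl !addr0. Qed.

Lemma biadd0r v : b v 0 = 0.
Proof. by apply: (addrI (b v 0)); rewrite -biaddDr !addr0. Qed.

Lemma biaddNl u v : b (- u) v = - b u v.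
Proof. by apply/eqP; rewrite -addr_eq0 -biaddDl addNr biadd0l. Qed.

Lemma biaddNr u v : b u (- v) = - b u v.
Proof. by apply/eqP; rewrite -addr_eq0 -biaddDr addNr biadd0r. Qed.

End BiaddTheory.

(** The alias keeps the group law twisted by the cocycle [b] apart from the componentwise law on
    pairs. *)
Definition cext (V D : finZmodType) (b : biadd V D) : Type := (V * D)%type.

Section CentralExtension.
Import GRing.Theory.
Variables (V D : finZmodType) (b : biadd V D).
Local Notation E := (cext b).

HB.instance Definition _ := Finite.on E.

Definition cext_mul (x y : E) : E := (x.1 + y.1, x.2 + y.2 + b x.1 y.1)%R.
Definition cext_one : E := (0, 0)%R.
Definition cext_inv (x : E) : E := (- x.1, b x.1 x.1 - x.2)%R.

Fact cext_mulA : associative cext_mul.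
Proof.
move=> [u c] [v d] [w e]; congr (_, _); rewrite /= ?addrA // biaddDl biaddDr.
rewrite -!addrA; do 2!congr (_ + _)%R; rewrite [RHS]addrCA; congr (_ + _)%R.
by rewrite addrC -addrA.
Qed.

Fact cext_mul1 : left_id cext_one cext_mul.
Proof. by move=> [u c]; rewrite /cext_mul /= biadd0l !add0r addr0. Qed.

Fact cext_mulV : left_inverse cext_one cext_inv cext_mul.
Proof.
move=> [u c]; rewrite /cext_mul /= biaddNl addNr; congr (_, _).
by rewrite addrNK subrr.
Qed.

HB.instance Definition _ := Finite_isGroup.Build E cext_mulA cext_mul1 cext_mulV.

Lemma cext_mulE (x y : E) : x * y = (x.1 + y.1, x.2 + y.2 + b x.1 y.1)%R :> E.
Proof. by []. Qed.

Lemma cext_commE (x y : E) : [~ x, y] = (0, b x.1 y.1 - b y.1 x.1)%R :> E.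
Proof.
apply: (mulgI (y * x)); rewrite -commgC.
case: x y => [u c] [v d]; rewrite !cext_mulE /=; congr (_, _).
  by rewrite addr0 addrC.
rewrite biadd0r addr0 [(d + c)%R]addrC -[RHS]addrA [X in _ = (_ + X)%R]addrCA.
by rewrite subrr addr0.
Qed.

Lemma cext_snd_morphM : {in setT &, {morph (fun d : D => (0, d)%R : E) : c d / c * d}}.
Proof. by move=> c d _ _; rewrite cext_mulE /= biadd0l !addr0. Qed.
Canonical cext_in := Morphism cext_snd_morphM.

Lemma cext_fst_morphM : {in setT &, {morph (fun x : E => x.1 : V) : x y / x * y}}.
Proof. by []. Qed.
Canonical cext_pr := Morphism cext_fst_morphM.

Lemma cext_expE (x : E) n : b x.1 x.1 = 0%R -> x ^+ n = (x.1 *+ n, x.2 *+ n)%R :> E.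
Proof.
move=> b0; have bn : b (x.1 *+ n)%R x.1 = 0%R.
  by elim: n => [|n IHn]; rewrite ?mulr0n ?biadd0l // mulrSr biaddDl b0 IHn addr0.
elim: n bn => [//|n IHn]; rewrite mulrSr biaddDl b0 addr0 => bn.
by rewrite expgSr IHn // cext_mulE /= bn addr0 -!mulrSr.
Qed.

End CentralExtension.

(** * The commutator map in coordinates *)

Section Coordinates.
Import GRing.Theory.
Variables (gT : finGroupType) (G : {group gT}) (p n d : nat).
Hypotheses (p_pr : prime p) (G2 : G^`(1) \subset 'Z(G)).
Hypotheses (abV : p.-abelem (G / 'Z(G))) (abD : p.-abelem G^`(1)).
Hypotheses (cardV : #|G : 'Z(G)| = (p ^ n)%N) (cardD : #|G^`(1)| = (p ^ d)%N).

Lemma abelem_isog_rV (aT : finGroupType) (A : {group aT}) k :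
  p.-abelem A -> #|A| = (p ^ k)%N -> A \isog [set: 'rV['F_p]_k].
Proof.
move=> abA cA; rewrite (isog_abelem_card [set: _]%G abA) mx_Fp_abelem //=.
by rewrite cardsT card_mx card_Fp // mul1n cA.
Qed.

(** The map [b] is read off from a section [s] of [f]. A commutator does not change when its entries
    are altered by central elements, so the choice of [s] is immaterial and [b] inherits additivity
    from class 2. *)
Lemma class2_coordinates :
  exists (f : {morphism G >-> 'rV['F_p]_n}) (q : {morphism [set: 'rV['F_p]_d] >-> gT})
         (b : biadd 'rV['F_p]_n 'rV['F_p]_d),
  [/\ 'ker f = 'Z(G), f @* G = setT, 'ker q = 1, q @* setT = G^`(1)
    & forall x y, x \in G -> y \in G -> [~ x, y] = q (b (f x) (f y))].
Proof.
have nZ : G \subset 'N('Z(G)) := normal_norm (center_normal G).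
have /isogP[f0 injf0 imf0] : (G / 'Z(G))%G \isog [set: 'rV['F_p]_n].
  by apply: abelem_isog_rV; rewrite ?card_quotient.
have /isogP[q injq imq] : [set: 'rV['F_p]_d] \isog (G^`(1))%G.
  by rewrite isog_sym; apply: abelem_isog_rV.
have fM : {in G &, {morph (fun x => f0 (coset 'Z(G) x)) : x y / x * y}}.
  by move=> x y Gx Gy /=; rewrite morphM ?(subsetP nZ) // morphM //; apply: mem_quotient.
pose f := Morphism fM.
have fE x : f x = f0 (coset 'Z(G) x) by [].
have feq x y : x \in G -> y \in G -> f x = f y -> x * y^-1 \in 'Z(G).
  move=> Gx Gy eqf; have eqc : coset 'Z(G) x = coset 'Z(G) y.
    by apply: (injmP injf0); rewrite ?mem_quotient.
  apply: coset_idr.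
    by rewrite groupM ?groupV ?(subsetP nZ).
  by rewrite morphM ?groupV ?(subsetP nZ) // morphV ?(subsetP nZ) //= eqc mulgV.
have kerf : 'ker f = 'Z(G).
  apply/setP=> x; apply/idP/idP=> [kx|Zx].
    have Gx := dom_ker kx; rewrite -[x]mulg1 -invg1 feq ?group1 //.
    by rewrite (mker kx) morph1.
  have Gx : x \in G by case/setIP: Zx.
  by apply/kerP=> //; rewrite fE coset_id // morph1.
have imf : f @* G = setT.
  apply/setP=> v; rewrite inE; have : v \in f0 @* (G / 'Z(G)) by rewrite imf0 inE.
  case/morphimP=> c _ /morphimP[x _ Gx ->] ->; rewrite -fE; exact: mem_morphim.
pose s (u : 'rV['F_p]_n) := odflt 1 [pick x in G | f x == u].
have sP u : s u \in G /\ f (s u) = u.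
  rewrite /s; case: pickP => [x /andP[Gx /eqP]//|no].
  have : u \in f @* G by rewrite imf inE.
  by case/morphimP=> x _ Gx ux; have := no x; rewrite Gx ux eqxx.
have commE x y : x \in G -> y \in G -> [~ x, y] = [~ s (f x), s (f y)].
  have fs z w : z \in G -> w \in G -> [~ z, w] = [~ s (f z), w].
    move=> Gz Gw; have [Gs fsz] := sP (f z).
    have /centerP[_ /(_ w Gw) cz] := feq z (s (f z)) Gz Gs (esym fsz).
    rewrite -{1}[z](mulgKV (s (f z))) (class2_commMg G2) ?groupM ?groupV //.
    by have /commgP/eqP-> := cz; rewrite mul1g.
  move=> Gx Gy; have [Gsx _] := sP (f x); have [Gsy _] := sP (f y).
  by rewrite (fs x y) // -(invg_comm y) (fs y) // invg_comm.
pose b0 u v : 'rV['F_p]_d := invm injq [~ s u, s v].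
have imcomm x y : x \in G -> y \in G -> [~ x, y] \in q @* setT.
  by move=> Gx Gy; rewrite imq mem_commg.
have Gs u : s u \in G by case: (sP u).
have fs u : f (s u) = u by case: (sP u).
have b0E x y : x \in G -> y \in G -> b0 (f x) (f y) = invm injq [~ x, y].
  by move=> Gx Gy; rewrite /b0 -commE.
have b0Dl u v w : b0 (u + v)%R w = (b0 u w + b0 v w)%R.
  rewrite -(fs u) -(fs v) -(fs w) -[(f (s u) + _)%R]/(f (s u) * f (s v)) -morphM //.
  rewrite !b0E ?groupM // (class2_commMg G2) //.
  by rewrite (morphM [morphism of invm injq]) ?imcomm.
have b0Dr u v w : b0 w (u + v)%R = (b0 w u + b0 w v)%R.
  rewrite -(fs u) -(fs v) -(fs w) -[(f (s u) + _)%R]/(f (s u) * f (s v)) -morphM //.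
  rewrite !b0E ?groupM // (class2_commgM G2) //.
  by rewrite (morphM [morphism of invm injq]) ?imcomm.
exists f, q, (Biadd b0Dl b0Dr); split=> //; first exact/trivgP.
by move=> x y Gx Gy /=; rewrite b0E // invmK ?imcomm.
Qed.

End Coordinates.

Section BiaddMultiples.
Import GRing.Theory.
Local Open Scope ring_scope.

Lemma biadd_antisym (V D : zmodType) (b : biadd V D) :
  (forall u, b u u = 0) -> forall u v, b v u = - b u v.
Proof.
move=> b0 u v; apply/eqP; rewrite -addr_eq0.
by have := b0 (u + v); rewrite biaddDl !biaddDr !b0 add0r addr0 addrC => ->.
Qed.

Lemma biaddMn_subproof_l (V D : zmodType) (b : biadd V D) k u v w :
  b (u + v) w *+ k = b u w *+ k + b v w *+ k.
Proof. by rewrite biaddDl mulrnDl. Qed.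

Lemma biaddMn_subproof_r (V D : zmodType) (b : biadd V D) k u v w :
  b w (u + v) *+ k = b w u *+ k + b w v *+ k.
Proof. by rewrite biaddDr mulrnDl. Qed.

Definition biaddMn (V D : zmodType) (b : biadd V D) k :=
  Biadd (biaddMn_subproof_l b k) (biaddMn_subproof_r b k).

Lemma rV_Fp_mulrn p m (v : 'rV['F_p]_m) : prime p -> v *+ p = 0.
Proof. by move=> p_pr; rewrite -scaler_nat pchar_Fp_0 // scale0r. Qed.

(** Every scalar of ['F_p] is a multiple of 1, so additivity gives linearity. *)
Lemma biaddZl p m n (b : biadd 'rV['F_p]_m 'rV['F_p]_n) c u v : b (c *: u) v = c *: b u v.
Proof.
rewrite -[c]natr_Zp !scaler_nat; elim: (c : nat) => [|k IHk].
  by rewrite !mulr0n biadd0l.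
by rewrite !mulrSr biaddDl IHk.
Qed.

Lemma biaddZr p m n (b : biadd 'rV['F_p]_m 'rV['F_p]_n) c u v : b u (c *: v) = c *: b u v.
Proof.
rewrite -[c]natr_Zp !scaler_nat; elim: (c : nat) => [|k IHk].
  by rewrite !mulr0n biadd0r.
by rewrite !mulrSr biaddDr IHk.
Qed.

End BiaddMultiples.

Section CextTheory.
Import GRing.Theory.
Variables (V D : finZmodType) (b : biadd V D).
Local Notation E := (cext b).

Lemma injm_cext_in : 'ker (cext_in b) = 1.
Proof. by apply/trivgP/injmP => c d _ _ []. Qed.

Lemma cext_der1_sub : [set: E]^`(1) \subset cext_in b @* setT.
Proof.
rewrite gen_subG; apply/subsetP=> _ /imset2P[x y _ _ ->].
by rewrite cext_commE (mem_morphim (cext_in b)) ?inE.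
Qed.

End CextTheory.

(** * Commutator subgroup of order p^3: the Camina case *)

Section SemiExtraspecial.
Import GRing.Theory.
Variables (gT : finGroupType) (G : {group gT}) (p : nat).
Hypotheses (p_pr : prime p) (p_gt2 : 2 < p) (pG : p.-group G).
Hypothesis classG : forall x, x \in G -> x \notin 'Z(G) -> #|x ^: G| = (p ^ 3)%N.
Hypothesis G2 : G^`(1) \subset 'Z(G).
Hypothesis cardG' : #|G^`(1)| = (p ^ 3)%N.

(** For noncentral [x] the group [[x, G]] has the order of G', hence [b u] is onto for every
    [u <> 0]. In the extension this says that the commutators with an element outside H' fill H',
    which is the Camina condition. *)
Lemma isoclinic_camina :
  exists (hT : finGroupType) (H : {group hT}),
    [/\ p.-group H, camina H, nil_class H = 2, #|H^`(1)| = (p ^ 3)%N & isoclinic G H].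
Proof.
have [n nE] := pgroup_index_pfactor p_pr pG (center_sub G).
have [f [q [b [kerf imf kerq imq commE]]]] :=
  class2_coordinates p_pr G2 (abelem_quotient_center p_pr classG G2)
    (abelem_der1 p_pr classG G2) nE cardG'.
have injq : 'injm q by rewrite kerq.
have lift u : exists2 x, x \in G & u = f x.
  have : u \in f @* G by rewrite imf inE.
  by case/morphimP=> x _ Gx ->; exists x.
have b_alt u : b u u = 0%R.
  have [x Gx ->] := lift u; apply: (injmP injq); rewrite ?inE // -commE //.
  by rewrite commgg morph1.
have b_surj u d : u <> 0%R -> exists v, b u v = d.
  have [x Gx ->] := lift u => fx.
  have nZx : x \notin 'Z(G) by apply/negP; rewrite -kerf => /mker.
  have DG' : [~: [set x], G] = G^`(1).
    by apply/eqP; rewrite eqEcard comm1_sub //= (card_comm1 G2 Gx) classG ?cardG'.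
  have : q d \in [~: [set x], G] by rewrite DG' -imq mem_morphim ?inE.
  case/(comm1P G2 _ Gx)=> g Gg; rewrite commE // => /(injmP injq) qd.
  by exists (f g); rewrite -qd ?inE.
(* [uphalf p = (p + 1) / 2] is the inverse of 2 modulo [p]; antisymmetrising [g] gives back [b]. *)
pose g := biaddMn b (uphalf p).
pose hT : finGroupType := cext g; pose H := [set: hT]%G.
have gE u v : (g u v - g v u = b u v)%R.
  have op : odd p by case: (even_prime p_pr) p_gt2 => [->|].
  rewrite /= (biadd_antisym b_alt u v) mulNrn opprK -mulrnDr addnn odd_uphalfK //.
  by rewrite mulrSr rV_Fp_mulrn // add0r.
have commH (x y : hT) : [~ x, y] = cext_in g (b x.1 y.1).
  by rewrite cext_commE gE.
have imH' : cext_in g @* setT = H^`(1).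
  apply/eqP; rewrite eqEsubset cext_der1_sub andbT; apply/subsetP=> _ /morphimP[d _ _ ->].
  have [u nzu] : exists u : 'rV['F_p]_n, u <> 0%R.
    have [x Gx nZx] : exists2 x, x \in G & x \notin 'Z(G).
      apply/subsetPn/negP => sGZ; move: cardG'.
      have -> : G^`(1) = 1 by apply/commG1P/(subset_trans sGZ)/subsetIr.
      move/eqP; rewrite cards1 -(expn0 p) eqn_exp2l ?prime_gt1 //.
    exists (f x) => fx; case/negP: nZx; rewrite -kerf; exact/kerP.
  have [v <-] := b_surj u d nzu.
  by rewrite -(commH (u, 0%R) (v, 0%R)) mem_commg ?inE.
have pF k : p.-nat #|'rV['F_p]_k| by rewrite card_mx card_Fp // pnatX pnat_id.
have H2 : H^`(1) \subset 'Z(H).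
  rewrite -imH'; apply/subsetP=> _ /morphimP[d _ _ ->]; apply/centerP.
  split=> [|y _]; first by rewrite inE.
  by apply/commgP; rewrite commH biadd0l morph1.
have cardH' : #|H^`(1)| = (p ^ 3)%N.
  rewrite -imH' card_injm ?injm_cext_in ?cardsT //.
  by rewrite card_mx card_Fp // mul1n.
exists hT, H; split=> //.
- by rewrite /pgroup cardsT card_prod pnatM !pF.
- move=> x /setDP[_ nH'x]; apply/eqP; rewrite eqEsubset.
  rewrite class_sub_der1_lcoset ?inE //=; apply/subsetP=> y.
  rewrite mem_lcoset -imH' => /morphimP[d _ _ yE].
  have nz : x.1 <> 0%R.
    move=> x0; case/negP: nH'x; rewrite -imH'; apply/morphimP.
    by exists x.2; rewrite ?inE // [LHS]surjective_pairing x0.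
  have [v bv] := b_surj x.1 d nz; apply/imsetP; exists ((v, 0%R) : hT); rewrite ?inE //.
  by apply: (mulgI x^-1); rewrite yE -commgEl commH /= bv.
- apply/eqP; rewrite eqn_leq nil_class2 H2 ltnNge nil_class1 /=.
  apply/negP=> /derG1P H'1; move: cardH'; rewrite H'1 cards1 => /eqP.
  by rewrite -(expn0 p) eqn_exp2l ?prime_gt1.
apply: (isoclinic_crit (f1 := f) (f2 := cext_pr g) (q1 := q) (q2 := cext_in g) (kappa := b)) => //.
- rewrite imf; apply/setP=> u; rewrite inE; symmetry; apply/morphimP.
  by exists ((u, 0%R) : hT); rewrite ?inE.
- by rewrite kerq injm_cext_in.
by move=> x y _ _; rewrite inE.
Qed.

End SemiExtraspecial.

(** * The group G_3 *)

Definition o0 : 'I_4 := @Ordinal 4 0 isT.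
Definition o1 : 'I_4 := @Ordinal 4 1 isT.
Definition o2 : 'I_4 := @Ordinal 4 2 isT.
Definition o3 : 'I_4 := @Ordinal 4 3 isT.

(* The six pairs [i < j] of indices below 4, in lexicographic order. *)
Definition lo (k : 'I_6) : 'I_4 := nth o0 [:: o0; o0; o0; o1; o1; o2] k.
Definition hi (k : 'I_6) : 'I_4 := nth o0 [:: o1; o2; o3; o2; o3; o3] k.

Lemma lo_lt_hi k : lo k < hi k.
Proof. by case: k => [[|[|[|[|[|[|//]]]]]] ?]. Qed.

Section CollectionCocycle.
Import GRing.Theory.
Variable p : nat.

(** The cocycle of collection: with [i < j], moving [a_i^(v_i)] to the left past [a_j^(u_j)] leaves
    [[a_i, a_j]] to the power [- u_j v_i]. *)
Definition cocycle3_fun (u v : 'rV['F_p]_4) : 'rV['F_p]_6 :=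
  (\row_k (- (u 0 (hi k) * v 0 (lo k))))%R.

Fact cocycle3_Dl u v w :
  cocycle3_fun (u + v)%R w = (cocycle3_fun u w + cocycle3_fun v w)%R.
Proof. by apply/rowP=> k; rewrite !mxE mulrDl opprD. Qed.

Fact cocycle3_Dr u v w :
  cocycle3_fun w (u + v)%R = (cocycle3_fun w u + cocycle3_fun w v)%R.
Proof. by apply/rowP=> k; rewrite !mxE mulrDr opprD. Qed.

Definition cocycle3 := Biadd cocycle3_Dl cocycle3_Dr.

(** The Pluecker coordinates of [u] and [v]. *)
Definition wedge (F : comNzRingType) (u v : 'rV[F]_4) : 'rV[F]_6 :=
  (\row_k (u 0 (lo k) * v 0 (hi k) - u 0 (hi k) * v 0 (lo k)))%R.

Lemma wedge_cocycle3 u v : (cocycle3 u v - cocycle3 v u)%R = wedge u v.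
Proof. by apply/rowP=> k; rewrite !mxE opprK addrC [(v _ _ * _)%R]mulrC. Qed.

End CollectionCocycle.

(** * Collection in an arbitrary group *)

Section Collection.
Variable hT : groupType.
Implicit Types A B X Y Z x y z c : hT.

Lemma swap_mul X Y B Z1 Z2 : X * B = B * X * Z1 -> Y * B = B * Y * Z2 ->
  commute Z1 Y -> (X * Y) * B = B * (X * Y) * (Z1 * Z2).
Proof.
move=> XB YB Z1Y; rewrite -mulgA YB !mulgA XB -!mulgA; do 2!congr (_ * _).
by rewrite !mulgA Z1Y.
Qed.

Lemma collect_mul A X B Y Z : X * B = B * X * Z -> commute Z Y ->
  (A * X) * (B * Y) = (A * B) * ((X * Y) * Z).
Proof.
by move=> XB ZY; rewrite -!mulgA (mulgA X B) XB -!mulgA ZY.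
Qed.

Lemma swap_exp x y z m n : y * x = x * y * z -> commute z x -> commute z y ->
  y ^+ m * x ^+ n = x ^+ n * y ^+ m * z ^+ (m * n).
Proof.
move=> yx zx zy.
have ymx k : y ^+ k * x = x * y ^+ k * z ^+ k.
  elim: k => [|k IHk]; first by rewrite !expg0 !mulg1 mul1g.
  by rewrite !(expgS _ k) (swap_mul yx IHk) //; apply: commuteX.
have zmx k : commute (z ^+ m) (x ^+ k) by apply: commuteX; apply/commute_sym/commuteX.
elim: n => [|n IHn]; first by rewrite muln0 !expg0 !mulg1 mul1g.
rewrite expgS mulgA ymx -!mulgA zmx (mulgA (y ^+ m)) IHn mulnS addnC expgnDr.
by rewrite !mulgA.
Qed.

Variable p : nat.
Hypothesis p_pr : prime p.

(** The exponent is the representative of [a] below [p], so the usual laws hold for elements with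
    [x ^+ p = 1]. *)
Definition expF x (a : 'F_p) : hT := x ^+ a.

Lemma expgn_mod x m : x ^+ p = 1 -> x ^+ (m %% p) = x ^+ m.
Proof.
by move=> xp; rewrite {2}(divn_eq m p) expgnDr mulnC expgnA xp expg1n mul1g.
Qed.

Lemma expFD x a b : x ^+ p = 1 -> expF x (a + b)%R = expF x a * expF x b.
Proof.
move=> xp; rewrite /expF -expgnDr -[RHS]expgn_mod //.
by congr (_ ^+ _); rewrite /=; congr (_ %% _)%N; apply: Fp_cast.
Qed.

Lemma expFM x a b : x ^+ p = 1 -> expF x (a * b)%R = x ^+ (a * b)%N.
Proof. move=> xp; rewrite /expF -[RHS]expgn_mod //.
by congr (_ ^+ _); rewrite /=; congr (_ %% _)%N; apply: Fp_cast. Qed.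

Lemma expF0 x : expF x 0%R = 1.
Proof. by []. Qed.

Lemma expF1 x : expF x 1%R = x.
Proof. by rewrite /expF /= modn_small ?Fp_cast ?prime_gt1. Qed.

Lemma expFN x a : x ^+ p = 1 -> expF x (- a)%R = (expF x a)^-1.
Proof.
by move=> xp; apply: (mulgI (expF x a)); rewrite -expFD // GRing.subrr mulgV.
Qed.

Section Presentation.
Variables (b : 'I_4 -> hT).
Hypothesis bX : forall i, b i ^+ p = 1.
Hypothesis bC : forall i j k : 'I_4, i < j -> [~ b k, [~ b i, b j]] = 1.
Hypothesis cX : forall i j : 'I_4, i < j -> [~ b i, b j] ^+ p = 1.

Let c k := [~ b (lo k), b (hi k)].
Let cXp k : c k ^+ p = 1. Proof. exact/cX/lo_lt_hi. Qed.
Let bcC i k : commute (b i) (c k).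
Proof. by apply/commgP; rewrite bC ?lo_lt_hi. Qed.
Let cC k x : (forall i, commute x (b i)) -> commute x (c k).
Proof.
by move=> xb; apply: commuteM; [apply: commuteV | rewrite conjgE; do ?apply: commuteM => //; apply: commuteV].
Qed.

Definition powV (u : 'rV['F_p]_4) : hT :=
  expF (b o0) (u 0%R o0) * (expF (b o1) (u 0%R o1) *
    (expF (b o2) (u 0%R o2) * expF (b o3) (u 0%R o3))).

Definition powD (w : 'rV['F_p]_6) : hT := \prod_(k < 6) expF (c k) (w 0%R k).

Let expF_commute x y m n : commute x y -> commute (expF x m) (expF y n).
Proof. exact: commuteX2. Qed.

Lemma powD_M (u v : 'rV['F_p]_6) : powD (u + v)%R = powD u * powD v.
Proof.
rewrite -prodgM_commute => [|i j _ _].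
  by apply: eq_bigr => k _; rewrite mxE expFD.
by apply: expF_commute; apply: cC => k; apply/commute_sym/bcC.
Qed.

Lemma powV_powD_commute u w : commute (powV u) (powD w).
Proof.
apply/commute_sym/commute_sym/commute_prod => k _.
by apply/commute_sym; do ?apply: commuteM; apply: expF_commute; apply/commute_sym/bcC.
Qed.

Let swap k (x y : 'F_p) : expF (b (hi k)) x * expF (b (lo k)) y =
  expF (b (lo k)) y * expF (b (hi k)) x * expF (c k) (- (x * y))%R.
Proof.
rewrite expFN // expFM //.
have -> : (c k ^+ (x * y)%N)^-1 = (c k)^-1 ^+ (x * y)%N by rewrite expVgn.
apply: swap_exp; first by rewrite invg_comm -commgC.
  by apply/commute_sym/commuteV/bcC.
by apply/commute_sym/commuteV/bcC.
Qed.

(** The letters of the second word move left in order of index: the first passes three letters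
    ([e0]), the second two ([e1]), the third one ([s5]). What remains is a reordering of the
    commutators, which commute with everything in sight. *)
Lemma powV_M (u v : 'rV['F_p]_4) :
  powV u * powV v = powV (u + v)%R * powD (cocycle3 p u v).
Proof.
pose z k := expF (c k) (- (u 0%R (hi k) * v 0%R (lo k)))%R.
pose k0 := @Ordinal 6 0 isT; pose k1 := @Ordinal 6 1 isT; pose k2 := @Ordinal 6 2 isT.
pose k3 := @Ordinal 6 3 isT; pose k4 := @Ordinal 6 4 isT; pose k5 := @Ordinal 6 5 isT.
have -> : powD (cocycle3 p u v) = z k0 * (z k1 * (z k2 * (z k3 * (z k4 * z k5)))).
  rewrite /powD !big_ord_recl big_ord0 mulg1 /z.
  by do ![congr (_ * _)]; rewrite mxE; congr (expF (c _) (- (u 0 (hi _) * v 0 (lo _)))%R);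
    apply: val_inj.
have zb k i (x : 'F_p) : commute (z k) (expF (b i) x).
  by apply: expF_commute; apply/commute_sym/bcC.
have zz k l : commute (z k) (z l).
  by apply: expF_commute; apply: cC => i; apply/commute_sym/bcC.
rewrite /powV; set A0 := expF _ (u 0%R o0); set A1 := expF _ (u 0%R o1).
set A2 := expF _ (u 0%R o2); set A3 := expF _ (u 0%R o3).
set B0 := expF _ (v 0%R o0); set B1 := expF _ (v 0%R o1).
set B2 := expF _ (v 0%R o2); set B3 := expF _ (v 0%R o3).
have s0 : A1 * B0 = B0 * A1 * z k0 := swap k0 _ _.
have s1 : A2 * B0 = B0 * A2 * z k1 := swap k1 _ _.
have s2 : A3 * B0 = B0 * A3 * z k2 := swap k2 _ _.
have s3 : A2 * B1 = B1 * A2 * z k3 := swap k3 _ _.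
have s4 : A3 * B1 = B1 * A3 * z k4 := swap k4 _ _.
have s5 : A3 * B2 = B2 * A3 * z k5 := swap k5 _ _.
have e1 := swap_mul s3 s4 (zb _ _ _).
have e0 := swap_mul s0 (swap_mul s1 s2 (zb _ _ _)) (commuteM (zb _ _ _) (zb _ _ _)).
pose Z1 := z k0 * (z k1 * z k2); pose Z2 := z k3 * z k4.
have Z1b i (x : 'F_p) : commute Z1 (expF (b i) x).
  by apply/commute_sym; do ?[apply: commuteM]; apply/commute_sym/zb.
have Z2b i (x : 'F_p) : commute Z2 (expF (b i) x).
  by apply/commute_sym; apply: commuteM; apply/commute_sym/zb.
have Z2z k : commute Z2 (z k) by apply/commute_sym; apply: commuteM; apply: zz.
have Z1z k : commute Z1 (z k) by apply/commute_sym; do ?[apply: commuteM]; apply: zz.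
rewrite (collect_mul _ e0); last by do ?[apply: commuteM]; apply: Z1b.
rewrite (collect_mul _ e1); last by do ?[apply: commuteM]; apply: Z2b.
rewrite (collect_mul _ s5); last exact: zb.
rewrite !mxE !expFD // -!mulgA; do 8!congr (_ * _).
transitivity (z k5 * Z2 * Z1); first by rewrite -!mulgA.
transitivity (Z1 * (Z2 * z k5)); last by rewrite -!mulgA.
have -> : z k5 * Z2 = Z2 * z k5 by rewrite Z2z.
have Z21 : commute Z2 Z1 := commuteM (Z2z k0) (commuteM (Z2z k1) (Z2z k2)).
by rewrite -mulgA -(Z1z k5) (mulgA Z2) Z21 -mulgA.
Qed.

Lemma powV_delta i : powV (delta_mx 0%R i) = b i.
Proof.
by rewrite /powV !mxE /=; case: i => [[|[|[|[|//]]]] ilt];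
   rewrite /= ?mulr0n ?mulr1n ?expF0 ?expF1 ?mulg1 ?mul1g; congr b; apply: val_inj.
Qed.

Lemma powD0 : powD 0%R = 1.
Proof. by rewrite /powD big1 // => k _; rewrite mxE expF0. Qed.

End Presentation.

End Collection.

Section FreeClassTwo.
Import GRing.Theory.
Variable p : nat.
Hypothesis p_pr : prime p.
Local Notation E := (cext (cocycle3 p)).

Definition gen3 (i : 'I_4) : E := (delta_mx 0 i, 0)%R.

Lemma cext3_commE (x y : E) : [~ x, y] = cext_in (cocycle3 p) (wedge x.1 y.1).
Proof. by rewrite cext_commE wedge_cocycle3. Qed.

Lemma wedge_delta k : wedge (delta_mx 0%R (lo k)) (delta_mx 0%R (hi k)) = delta_mx 0%R k :> 'rV['F_p]_6.
Proof.
apply/rowP=> l; rewrite !mxE /=.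
case: k => [[|[|[|[|[|[|//]]]]]] klt]; case: l => [[|[|[|[|[|[|//]]]]]] llt];
  by rewrite -!val_eqE /= ?mulr1n ?mulr0n ?mulr1 ?mulr0 ?subr0.
Qed.

Lemma rV_Fp_group_full n (L : {group 'rV['F_p]_n}) :
  (forall k, delta_mx 0%R k \in L) -> L :=: setT.
Proof.
move=> deltaL; apply/setP=> u; rewrite inE (row_sum_delta u).
apply: (big_ind (fun v => v \in L)) => [|v w Lv Lw|k _].
- exact: group1.
- exact: groupM Lv Lw.
rewrite -[u 0%R k]natr_Zp scaler_nat; exact: groupX.
Qed.

Definition gens3 := [tuple gen3 o0; gen3 o1; gen3 o2; gen3 o3].

Lemma tnth_gens3 i : tnth gens3 i = gen3 i.
Proof.
by rewrite (tnth_nth 1); case: i => [[|[|[|[|//]]]] ilt] /=; congr gen3; apply: val_inj.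
Qed.

Lemma gen3_comm k :
  [~ gen3 (lo k), gen3 (hi k)] = cext_in (cocycle3 p) (delta_mx 0%R k).
Proof. by rewrite cext3_commE wedge_delta. Qed.

(** The commutators of the generators give a basis of the central part, and the generators
    themselves give a basis of the quotient. *)
Lemma gens3_generate : [set: E] = <<[set x in gens3]>>.
Proof.
set K := <<_>>; have Kgen i : gen3 i \in K.
  by rewrite mem_gen // inE -tnth_gens3 mem_tnth.
have KD d : cext_in (cocycle3 p) d \in K.
  have : d \in (cext_in (cocycle3 p) @*^-1 K)%G.
    rewrite rV_Fp_group_full ?inE // => k; apply/morphpreP.
    by rewrite inE -gen3_comm groupR.
  by case/morphpreP.
apply/esym/setP=> x; rewrite inE.
have : x.1 \in cext_pr (cocycle3 p) @* K.
  rewrite (@rV_Fp_group_full _ (cext_pr (cocycle3 p) @* K)%G) ?inE // => k.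
  by rewrite -[delta_mx _ _]/(cext_pr (cocycle3 p) (gen3 k)) mem_morphim ?inE.
case/morphimP=> y _ Ky xy.
have -> : x = y * cext_in (cocycle3 p) (x.2 - y.2)%R.
  transitivity ((y.1 + 0, y.2 + (x.2 - y.2) + cocycle3 p y.1 0)%R : E); last by [].
  by rewrite biadd0r !addr0 [(y.2 + _)%R]addrC subrK -[y.1]xy [LHS]surjective_pairing.
by rewrite groupM.
Qed.

Lemma gens3_relations : G_relations p gens3.
Proof.
have comm3 (x y z : E) : [~ z, [~ x, y]] = 1.
  have c0 : ([~ x, y] : E).1 = 0%R by rewrite cext_commE.
  by rewrite cext_commE c0 biadd0r biadd0l subr0.
split=> [i j k _|i|i j _] //.
- rewrite tnth_gens3 cext_expE /=; first by rewrite mul0rn rV_Fp_mulrn.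
  apply/rowP=> l; rewrite !mxE /=.
  have nl : (lo l == hi l) = false by rewrite -val_eqE /= ltn_eqF ?lo_lt_hi.
  by case: (hi l =P i) => [<-|_]; rewrite ?nl /= ?mulr0 ?mul0r oppr0.
rewrite cext3_commE cext_expE /=; first by rewrite mul0rn rV_Fp_mulrn.
exact: (biadd0l (cocycle3 p)).
Qed.

(** The required homomorphism sends a pair to its collected word times a product of powers of
    commutators; [powV_M] makes it multiplicative. *)
Lemma presented_gens3 : presented_G p [set: E]%G gens3.
Proof.
split; [exact: gens3_generate | exact: gens3_relations |].
move=> hT b [bC bX cX].
pose f (x : E) := powV (tnth b) x.1 * powD (tnth b) x.2.
exists f => [x y _ _|i].
  transitivity (powV (tnth b) x.1 * powV (tnth b) y.1 *
    (powD (tnth b) x.2 * powD (tnth b) y.2)).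
    rewrite powV_M // -mulgA -!powD_M // /f; congr (_ * powD _ _).
    by rewrite cext_mulE [RHS]addrC.
  have cm : commute (powV (tnth b) y.1) (powD (tnth b) x.2) by apply: powV_powD_commute.
  rewrite /f; move: (powV _ _) (powV _ _) (powD _ _) (powD _ _) cm => A B C D cm.
  by rewrite -!mulgA (mulgA B) cm -mulgA.
by rewrite tnth_gens3 /f /= powD0 mulg1 powV_delta.
Qed.

End FreeClassTwo.

(** * Normal forms of the relations *)

Section AdaptedBases.
Import GRing.Theory.
Local Open Scope ring_scope.
Variables (F : fieldType) (d : nat).
Hypothesis nz2 : 2%:R != 0 :> F.
Local Notation V := 'rV[F]_4.
Variable b : biadd V 'rV[F]_d.
Hypothesis biaddZl : forall c u v, b (c *: u) v = c *: b u v.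
Hypothesis biaddZr : forall c u v, b u (c *: v) = c *: b u v.
Hypothesis b_alt : forall u, b u u = 0.
Hypothesis b_aniso : forall u v, u <> 0 -> b u v = 0 -> exists c, v = c *: u.
Implicit Types x y : V.

Let bE := (biaddDl, biaddDr, biaddNl, biaddNr, biaddZl, biaddZr, b_alt).
Let bC u v : b v u = - b u v. Proof. exact: biadd_antisym. Qed.

(* Quantifying over all subspaces makes elementary basis changes immediate. *)
Definition spans x1 x2 x3 x4 := forall U : 'M[F]_4,
  (x1 <= U)%MS -> (x2 <= U)%MS -> (x3 <= U)%MS -> (x4 <= U)%MS -> (1%:M <= U)%MS.

Lemma spans_rank x1 x2 x3 x4 y1 y2 y3 : spans x1 x2 x3 x4 ->
  ~ [/\ (x1 <= y1 + y2 + y3)%MS, (x2 <= y1 + y2 + y3)%MS,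
        (x3 <= y1 + y2 + y3)%MS & (x4 <= y1 + y2 + y3)%MS].
Proof.
move=> sp [x1U x2U x3U x4U]; have := mxrankS (sp _ x1U x2U x3U x4U).
rewrite mxrank1 leqNgt ltnS => /negP[].
apply: leq_trans (mxrank_adds_leqif _ _) _.
apply: leq_trans (leq_add (mxrank_adds_leqif _ _) (leqnn _)) _.
by apply: leq_trans (leq_add (leq_add (rank_leq_row _) (rank_leq_row _)) (rank_leq_row _)) _.
Qed.

(** Otherwise [x2] would be a multiple of [x1], and a sum of three lines would contain a basis. *)
Lemma spans_neq0 x1 x2 x3 x4 : spans x1 x2 x3 x4 -> b x1 x2 <> 0.
Proof.
move=> sp b0; have [x10|nx1] := eqVneq x1 0.
  have := submx_refl (x2 + x3 + x4)%MS; rewrite {1}addsmx_sub {1}addsmx_sub.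
  by case/andP=> /andP[? ? ?]; apply: (spans_rank (y1 := x2) (y2 := x3) (y3 := x4) sp); rewrite x10 sub0mx; split=> //.
have [c x2E] := b_aniso (elimN eqP nx1) b0.
have := submx_refl (x1 + x3 + x4)%MS; rewrite {1}addsmx_sub {1}addsmx_sub.
case/andP=> /andP[x1S ? ?]; apply: (spans_rank (y1 := x1) (y2 := x3) (y3 := x4) sp).
by split=> //; rewrite x2E scalemx_sub.
Qed.

Lemma spans_swap12 x1 x2 x3 x4 : spans x1 x2 x3 x4 -> spans x2 x1 x3 x4.
Proof. by move=> sp U ? ? ? ?; apply: sp. Qed.

Lemma spans_swap34 x1 x2 x3 x4 : spans x1 x2 x3 x4 -> spans x1 x2 x4 x3.
Proof. by move=> sp U ? ? ? ?; apply: sp. Qed.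

Lemma spans_scale c1 c2 c3 c4 x1 x2 x3 x4 :
  c1 != 0 -> c2 != 0 -> c3 != 0 -> c4 != 0 -> spans x1 x2 x3 x4 ->
  spans (c1 *: x1) (c2 *: x2) (c3 *: x3) (c4 *: x4).
Proof.
have unscale c x (U : 'M[F]_4) : c != 0 -> (c *: x <= U)%MS -> (x <= U)%MS.
  by move=> nc /(scalemx_sub c^-1); rewrite scalerA mulVf ?scale1r.
move=> n1 n2 n3 n4 sp U h1 h2 h3 h4.
by apply: sp; [apply: unscale h1 | apply: unscale h2 | apply: unscale h3 | apply: unscale h4].
Qed.

(* Completes the leading part of a relation to [b P1 P2]; what is left over is a
   multiple of [b x3 x4]. *)
Lemma adapted_basis1_lead x1 x2 x3 x4 k13 k14 k23 k24 k34 : spans x1 x2 x3 x4 ->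
  b x1 x2 + k13 *: b x1 x3 + k14 *: b x1 x4 + k23 *: b x2 x3 + k24 *: b x2 x4
    + k34 *: b x3 x4 = 0 ->
  exists y1 y2 y3 y4, spans y1 y2 y3 y4 /\ b y1 y2 + b y3 y4 = 0.
Proof.
(* [c] is the Pfaffian of the relation. If it vanished, the relation would be [b y1 y2 = 0], that
   is, decomposable. *)
move=> sp rel; pose c := k34 + k23 * k14 - k24 * k13.
pose y1 := x1 - k23 *: x3 - k24 *: x4; pose y2 := x2 + k13 *: x3 + k14 *: x4.
have spy : spans y1 y2 x3 x4.
  move=> U U1 U2 U3 U4; apply: sp => //.
    rewrite (_ : x1 = y1 + k24 *: x4 + k23 *: x3); last by rewrite /y1 !subrK.
    by apply: addmx_sub (addmx_sub U1 _) _; apply: scalemx_sub.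
  rewrite (_ : x2 = y2 - k14 *: x4 - k13 *: x3); last by rewrite /y2 !addrK.
  by rewrite -!scaleNr; apply: addmx_sub (addmx_sub U2 _) _; apply: scalemx_sub.
have b12 : b y1 y2 + c *: b x3 x4 = 0.
  rewrite -[RHS]rel /y1 /y2 /c !bE (bC x2 x3) (bC x2 x4) (bC x3 x4).
  move: (b x1 x2) (b x1 x3) (b x1 x4) (b x2 x3) (b x2 x4) (b x3 x4) => *.
  by apply/rowP=> l; rewrite !mxE; ring.
have c0 : c != 0.
  by apply/eqP=> c0; case: (spans_neq0 spy); rewrite -b12 c0 scale0r addr0.
exists y1, y2, (c *: x3), (1 *: x4); split; last by rewrite biaddZl scale1r.
have := @spans_scale 1 1 c 1 _ _ _ _ (oner_neq0 _) (oner_neq0 _) c0 (oner_neq0 _) spy.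
by rewrite !scale1r.
Qed.

(** A permutation of the basis, with the sign changes it causes, brings a nonzero coefficient to the
    leading place. *)
Lemma adapted_basis1 x1 x2 x3 x4 k12 k13 k14 k23 k24 k34 : spans x1 x2 x3 x4 ->
  ~~ [&& k12 == 0, k13 == 0, k14 == 0, k23 == 0, k24 == 0 & k34 == 0] ->
  k12 *: b x1 x2 + k13 *: b x1 x3 + k14 *: b x1 x4 + k23 *: b x2 x3 + k24 *: b x2 x4
    + k34 *: b x3 x4 = 0 ->
  exists y1 y2 y3 y4, spans y1 y2 y3 y4 /\ b y1 y2 + b y3 y4 = 0.
Proof.
have main z1 z2 z3 z4 l12 l13 l14 l23 l24 l34 : spans z1 z2 z3 z4 -> l12 != 0 ->
    l12 *: b z1 z2 + l13 *: b z1 z3 + l14 *: b z1 z4 + l23 *: b z2 z3 + l24 *: b z2 z4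
      + l34 *: b z3 z4 = 0 ->
    exists y1 y2 y3 y4, spans y1 y2 y3 y4 /\ b y1 y2 + b y3 y4 = 0.
  move=> sp n12 /(congr1 (fun w => l12^-1 *: w)).
  rewrite scaler0 !scalerDr !scalerA mulVf // scale1r; exact: adapted_basis1_lead.
move=> sp nk rel.
have reorder z1 z2 z3 z4 l12 l13 l14 l23 l24 l34 : spans z1 z2 z3 z4 -> l12 != 0 ->
    l12 *: b z1 z2 + l13 *: b z1 z3 + l14 *: b z1 z4 + l23 *: b z2 z3 + l24 *: b z2 z4
      + l34 *: b z3 z4 =
    k12 *: b x1 x2 + k13 *: b x1 x3 + k14 *: b x1 x4 + k23 *: b x2 x3 + k24 *: b x2 x4
      + k34 *: b x3 x4 ->
    exists y1 y2 y3 y4, spans y1 y2 y3 y4 /\ b y1 y2 + b y3 y4 = 0.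
  by move=> spz nl; rewrite rel; apply: main.
have [k12_0|] := eqVneq k12 0; last by move=> nk12; apply: main sp nk12 rel.
have [k13_0|nk13] := eqVneq k13 0; last first.
  apply: (@reorder x1 x3 x2 x4 k13 k12 k14 (- k23) k34 k24).
  - by move=> U ? ? ? ?; apply: sp.
  - by [].
  rewrite (bC x2 x3); move: (b _ _) (b _ _) (b _ _) (b _ _) (b _ _) (b _ _) => *.
  by apply/rowP=> l; rewrite !mxE; ring.
have [k14_0|nk14] := eqVneq k14 0; last first.
  apply: (@reorder x1 x4 x3 x2 k14 k13 k12 (- k34) (- k24) (- k23)).
  - by move=> U ? ? ? ?; apply: sp.
  - by [].
  rewrite (bC x2 x3) (bC x2 x4) (bC x3 x4).
  move: (b _ _) (b _ _) (b _ _) (b _ _) (b _ _) (b _ _) => *.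
  by apply/rowP=> l; rewrite !mxE; ring.
have [k23_0|nk23] := eqVneq k23 0; last first.
  apply: (@reorder x2 x3 x1 x4 k23 (- k12) k24 (- k13) k34 k14).
  - by move=> U ? ? ? ?; apply: sp.
  - by [].
  rewrite (bC x1 x2) (bC x1 x3).
  move: (b _ _) (b _ _) (b _ _) (b _ _) (b _ _) (b _ _) => *.
  by apply/rowP=> l; rewrite !mxE; ring.
have [k24_0|nk24] := eqVneq k24 0; last first.
  apply: (@reorder x2 x4 x3 x1 k24 k23 (- k12) (- k34) (- k14) (- k13)).
  - by move=> U ? ? ? ?; apply: sp.
  - by [].
  rewrite (bC x1 x2) (bC x1 x3) (bC x1 x4) (bC x3 x4).
  move: (b _ _) (b _ _) (b _ _) (b _ _) (b _ _) (b _ _) => *.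
  by apply/rowP=> l; rewrite !mxE; ring.
have [k34_0|nk34] := eqVneq k34 0; last first.
  apply: (@reorder x3 x4 x1 x2 k34 (- k13) (- k23) (- k14) (- k24) k12).
  - by move=> U ? ? ? ?; apply: sp.
  - by [].
  rewrite (bC x1 x3) (bC x1 x4) (bC x2 x3) (bC x2 x4).
  move: (b _ _) (b _ _) (b _ _) (b _ _) (b _ _) (b _ _) => *.
  by apply/rowP=> l; rewrite !mxE; ring.
by case/negP: nk; rewrite k12_0 k13_0 k14_0 k23_0 k24_0 k34_0 eqxx.
Qed.

Section SecondRelation.
Variable t : F.
Hypothesis nonsquare_ratio : forall s : F, (forall r, r ^+ 2 != s) ->
  exists2 y, y != 0 & s = t * y ^+ 2.

(** Completion as for one relation, but only by basis changes that preserve the first relation. The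
    coefficient [delta] left over is minus the Pfaffian modulo that relation, up to the square
    absorbed from [l12]; it must be a non-square, and rescaling turns it into [t]. *)
Lemma adapted_basis2_lead x1 x2 x3 x4 l12 l14 l23 l24 : spans x1 x2 x3 x4 ->
  b x1 x2 + b x3 x4 = 0 ->
  b x1 x3 + l12 *: b x1 x2 + l14 *: b x1 x4 + l23 *: b x2 x3 + l24 *: b x2 x4 = 0 ->
  exists y1 y2 y3 y4, [/\ spans y1 y2 y3 y4, b y1 y2 + b y3 y4 = 0
    & b y1 y3 + t *: b y2 y4 = 0].
Proof.
move=> sp rel1 rel2; have b34 : b x3 x4 = - b x1 x2.
  by apply/eqP; rewrite -addr_eq0 addrC rel1.
(* [l12] is split into two halves because moving [x1] by [s *: x4] spoils the first relation unless
   [x3] is moved by [s *: x2]. *)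
pose s : F := l12 / 2%:R; have l12E : l12 = s + s by rewrite -mulr2n -mulr_natr mulfVK.
pose y1 := x1 + l23 *: x2 + s *: x4; pose y3 := x3 + l14 *: x4 + s *: x2.
pose delta := l24 - l23 * l14 + s ^+ 2.
have spy : spans y1 x2 y3 x4.
  move=> U U1 U2 U3 U4; apply: sp => //.
    rewrite (_ : x1 = y1 - s *: x4 - l23 *: x2); last by rewrite /y1 !addrK.
    by rewrite -!scaleNr; apply: addmx_sub (addmx_sub U1 _) _; apply: scalemx_sub.
  rewrite (_ : x3 = y3 - s *: x2 - l14 *: x4); last by rewrite /y3 !addrK.
  by rewrite -!scaleNr; apply: addmx_sub (addmx_sub U3 _) _; apply: scalemx_sub.
have r1 : b y1 x2 + b y3 x4 = 0.
  rewrite /y1 /y3 !bE (bC x2 x4) b34; move: (b _ _) (b _ _) => *.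
  by apply/rowP=> l; rewrite !mxE; ring.
have r2 : b y1 y3 + delta *: b x2 x4 = 0.
  rewrite -[RHS]rel2 /y1 /y3 /delta !bE (bC x2 x4) (bC x3 x4) b34 l12E.
  move: (b _ _) (b _ _) (b _ _) (b _ _) (b _ _) => *.
  by apply/rowP=> l; rewrite !mxE; ring.
(* If [delta = r ^+ 2], the second relation plus [r] times the first would be the decomposable
   relation [b z1 z3 = 0]. *)
clearbody y1 y3; have [|y ny dE] := nonsquare_ratio (s := delta).
  move=> r; apply/eqP=> rE; pose z1 := y1 - r *: x4; pose z3 := y3 + r *: x2.
  have spz : spans z1 z3 x2 x4.
    move=> U U1 U3 U2 U4; apply: spy => //.
      rewrite (_ : y1 = z1 + r *: x4); last by rewrite /z1 subrK.
      by apply: addmx_sub U1 _; apply: scalemx_sub.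
    rewrite (_ : y3 = z3 - r *: x2); last by rewrite /z3 addrK.
    by rewrite -!scaleNr; apply: addmx_sub U3 _; apply: scalemx_sub.
  case: (spans_neq0 spz).
  have b34' : b y3 x4 = - b y1 x2 by apply/eqP; rewrite -addr_eq0 addrC r1.
  rewrite -[RHS]r2 -rE /z1 /z3 biaddDl !biaddDr !biaddNl !biaddZl !biaddZr.
  rewrite (bC y3 x4) (bC x2 x4) b34'; move: (b _ _) (b _ _) (b _ _) => *.
  by apply/rowP=> l; rewrite !mxE; ring.
exists (y^-1 *: y1), (y *: x2), y3, x4; split.
- have := @spans_scale y^-1 y 1 1 _ _ _ _ _ ny (oner_neq0 _) (oner_neq0 _) spy.
  by rewrite !scale1r; apply; rewrite invr_eq0.
- by rewrite biaddZl biaddZr scalerA mulVf // scale1r.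
have -> : 0 = y^-1 *: (b y1 y3 + delta *: b x2 x4) by rewrite r2 scaler0.
rewrite !biaddZl scalerDr !scalerA dE; congr (_ + _ *: _).
by field.
Qed.

(** Signed permutations preserving the first relation bring any of [l13], [l23], [l14], [l24] to the
    leading place. If all four vanish, so does [l12], because [b x1 x2 <> 0]. *)
Lemma adapted_basis2 x1 x2 x3 x4 l12 l13 l14 l23 l24 : spans x1 x2 x3 x4 ->
  b x1 x2 + b x3 x4 = 0 ->
  ~~ [&& l12 == 0, l13 == 0, l14 == 0, l23 == 0 & l24 == 0] ->
  l12 *: b x1 x2 + l13 *: b x1 x3 + l14 *: b x1 x4 + l23 *: b x2 x3 + l24 *: b x2 x4 = 0 ->
  exists y1 y2 y3 y4, [/\ spans y1 y2 y3 y4, b y1 y2 + b y3 y4 = 0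
    & b y1 y3 + t *: b y2 y4 = 0].
Proof.
move=> sp rel1 nl rel2.
have main z1 z2 z3 z4 m12 m13 m14 m23 m24 : spans z1 z2 z3 z4 -> b z1 z2 + b z3 z4 = 0 ->
    m13 != 0 ->
    m12 *: b z1 z2 + m13 *: b z1 z3 + m14 *: b z1 z4 + m23 *: b z2 z3 + m24 *: b z2 z4 = 0 ->
    exists y1 y2 y3 y4, [/\ spans y1 y2 y3 y4, b y1 y2 + b y3 y4 = 0
      & b y1 y3 + t *: b y2 y4 = 0].
  move=> spz relz n13 rel; apply: (@adapted_basis2_lead z1 z2 z3 z4 (m13^-1 * m12)
    (m13^-1 * m14) (m13^-1 * m23) (m13^-1 * m24)) => //.
  have -> : 0 = m13^-1 *: (0 : 'rV[F]_d) by rewrite scaler0.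
  rewrite -rel !scalerDr !scalerA mulVf // scale1r.
  by congr (_ + _ + _ + _); rewrite addrC.
have spanN z1 z2 z3 z4 : spans z1 z2 z3 z4 -> spans z1 (- z2) z3 z4.
  move=> spz U U1 U2 U3 U4; apply: spz => //.
  by rewrite -[z2]opprK -scaleN1r; apply: scalemx_sub.
have spanN4 z1 z2 z3 z4 : spans z1 z2 z3 z4 -> spans z1 z2 z3 (- z4).
  move=> spz U U1 U2 U3 U4; apply: spz => //.
  by rewrite -[z4]opprK -scaleN1r; apply: scalemx_sub.
have [l13_0|] := eqVneq l13 0; last by move=> n13; apply: main sp rel1 n13 rel2.
have [l23_0|n23] := eqVneq l23 0; last first.
  apply: (main x2 (- x1) x3 x4 l12 l23 l24 (- l13) (- l14)) => //.
  - by apply: spanN; apply: spans_swap12.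
  - by rewrite biaddNr (bC x1 x2) opprK.
  by rewrite !biaddNr !biaddNl (bC x1 x2) !scaleNr !scalerN !opprK -rel2;
     move: (_ *: _) (_ *: _) (_ *: _) (_ *: _) (_ *: _) => *; apply/rowP=> l; rewrite !mxE; ring.
have [l14_0|n14] := eqVneq l14 0; last first.
  apply: (main x1 x2 x4 (- x3) l12 l14 (- l13) l24 (- l23)) => //.
  - by apply: spanN4; apply: spans_swap34.
  - by rewrite biaddNr (bC x3 x4) opprK.
  by rewrite !biaddNr !scaleNr !scalerN !opprK -rel2;
     move: (_ *: _) (_ *: _) (_ *: _) (_ *: _) (_ *: _) => *; apply/rowP=> l; rewrite !mxE; ring.
have [l24_0|n24] := eqVneq l24 0; last first.
  apply: (main x2 (- x1) x4 (- x3) l12 l24 (- l23) (- l14) l13) => //.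
  - by apply: spanN4; apply: spans_swap34; apply: spanN; apply: spans_swap12.
  - by rewrite !biaddNr (bC x1 x2) (bC x3 x4) !opprK.
  by rewrite !(biaddNr, biaddNl) (bC x1 x2) !scaleNr !scalerN !opprK -rel2;
     move: (_ *: _) (_ *: _) (_ *: _) (_ *: _) (_ *: _) => *; apply/rowP=> l; rewrite !mxE; ring.
move: rel2 nl; rewrite l13_0 l14_0 l23_0 l24_0 !scale0r !addr0 !eqxx !andbT => /eqP.
rewrite scaler_eq0 => /orP[-> //|/eqP b0 _].
by case: (spans_neq0 sp).
Qed.

End SecondRelation.

End AdaptedBases.

(** * Linear dependence and squares in finite fields *)

Section FieldFacts.
Import GRing.Theory.
Local Open Scope ring_scope.

Lemma exists_left_kernel (F : fieldType) m d (M : 'M[F]_(m, d)) :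
  (d < m)%N -> exists2 w : 'rV_m, w != 0 & w *m M = 0.
Proof.
move=> ltdm; have /rowV0Pn[w wK nw] : kermx M != 0.
  rewrite kermx_eq0 /row_free; apply: contraL ltdm => /eqP <-.
  by rewrite -leqNgt rank_leq_col.
by exists w => //; apply/sub_kermxP.
Qed.

(** The unit group is cyclic and non-squares are odd powers of a generator. *)
Lemma nonsquare_mul (F : finFieldType) (s t : F) :
  (forall r, r ^+ 2 != s) -> (forall r, r ^+ 2 != t) -> exists r, r ^+ 2 = s * t.
Proof.
move=> nsq_s nsq_t.
have nz (x : F) : (forall r, r ^+ 2 != x) -> x != 0.
  by move/(_ 0); rewrite expr0n /= eq_sym.
have /cyclicP[g gE] := field_unit_group_cyclic [set: {unit F}]%G.
have pow (x : F) : x != 0 -> exists k, x = val g ^+ k.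
  rewrite -unitfE => Ux; have : FinRing.unit F Ux \in <[g]>%g by rewrite -gE inE.
  by case/cycleP=> k /(congr1 val); rewrite /= FinRing.val_unitX; exists k.
have odd_pow (x : F) : (forall r, r ^+ 2 != x) -> exists k, x = val g ^+ k.*2.+1.
  move=> nsq; have [k xE] := pow x (nz x nsq); case: (boolP (odd k)) => ok.
    by exists k./2; rewrite xE -{1}(odd_double_half k) ok.
  by case/eqP: (nsq (val g ^+ k./2)); rewrite xE -exprM muln2 even_halfK.
have [i ->] := odd_pow s nsq_s; have [j ->] := odd_pow t nsq_t.
exists (val g ^+ (i + j).+1); rewrite -exprM -exprD; congr (_ ^+ _); lia.
Qed.

Lemma nonsquare_ratio (F : finFieldType) (s t : F) :
  (forall r, r ^+ 2 != s) -> (forall r, r ^+ 2 != t) -> exists2 y, y != 0 & s = t * y ^+ 2.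
Proof.
move=> nsq_s nsq_t; have [r rE] := nonsquare_mul nsq_s nsq_t.
have nzs : s != 0 by have := nsq_s 0; rewrite expr0n /= eq_sym.
have nzt : t != 0 by have := nsq_t 0; rewrite expr0n /= eq_sym.
exists (r / t); last by rewrite expr_div_n rE; field.
by apply: mulf_neq0; rewrite ?invr_eq0 //; apply: contraTneq (mulf_neq0 nzs nzt) => r0;
   rewrite -rE r0 expr0n eqxx.
Qed.

Lemma square_mod_Fp p (t : int) : prime p -> ~ square_mod p t ->
  forall s : 'F_p, s ^+ 2 != t%:~R.
Proof.
move=> p_pr nsq s; apply/eqP=> sE; apply: nsq; exists (s : nat)%:Z.
apply/eqP; rewrite eqz_mod_dvd (dvdz_pcharf (pchar_Fp p_pr)).
by rewrite rmorphB rmorphXn /= -pmulrn natr_Zp sE subrr.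
Qed.

End FieldFacts.

(** * Alternating maps as maps on the exterior square *)

Section BiaddMatrix.
Import GRing.Theory.
Local Open Scope ring_scope.
Variables (F : comNzRingType) (d : nat) (b : biadd 'rV[F]_4 'rV[F]_d).
Hypothesis biaddZl : forall c u v, b (c *: u) v = c *: b u v.
Hypothesis biaddZr : forall c u v, b u (c *: v) = c *: b u v.
Hypothesis b_alt : forall u, b u u = 0.

(** The linear map that [b] induces on the exterior square; its left kernel is the space of
    relations among the commutators of the basis. *)
Definition wedge_mx : 'M[F]_(6, d) :=
  \matrix_k b (delta_mx 0 (lo k)) (delta_mx 0 (hi k)).

Lemma rV4E (u : 'rV[F]_4) :
  u = u 0 o0 *: delta_mx 0 o0 + u 0 o1 *: delta_mx 0 o1 + u 0 o2 *: delta_mx 0 o2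
    + u 0 o3 *: delta_mx 0 o3.
Proof.
rewrite {1}[u]row_sum_delta !big_ord_recl big_ord0 addr0 !addrA.
by do ![congr (_ + _)]; congr (u 0 _ *: delta_mx 0 _); apply: val_inj.
Qed.

Lemma sum6E (V : zmodType) (G : 'I_6 -> V) (k0 := @Ordinal 6 0 isT)
  (k1 := @Ordinal 6 1 isT) (k2 := @Ordinal 6 2 isT) (k3 := @Ordinal 6 3 isT)
  (k4 := @Ordinal 6 4 isT) (k5 := @Ordinal 6 5 isT) :
  \sum_k G k = G k0 + G k1 + G k2 + G k3 + G k4 + G k5.
Proof.
by rewrite !big_ord_recl big_ord0 addr0 !addrA; do ![congr (_ + _)]; congr G; apply: val_inj.
Qed.

Lemma biadd_wedge u v : b u v = wedge u v *m wedge_mx.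
Proof.
rewrite mulmx_sum_row sum6E !rowK ![wedge _ _ _ _]mxE /lo /hi /=.
rewrite {1}(rV4E u) {1}(rV4E v).
set e0 := delta_mx 0 o0; set e1 := delta_mx 0 o1; set e2 := delta_mx 0 o2.
set e3 := delta_mx 0 o3.
have bC x y : b y x = - b x y by apply: biadd_antisym.
clearbody e0 e1 e2 e3; move: (u 0 _) (u 0 _) (u 0 _) (u 0 _) (v 0 _) (v 0 _) (v 0 _) (v 0 _).
move=> u0 u1 u2 u3 v0 v1 v2 v3.
rewrite !biaddDl !biaddDr !biaddZl !biaddZr !b_alt.
rewrite (bC e0 e1) (bC e0 e2) (bC e0 e3) (bC e1 e2) (bC e1 e3) (bC e2 e3).
move: (b _ _) (b _ _) (b _ _) (b _ _) (b _ _) (b _ _) => *.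
by apply/rowP=> l; rewrite !mxE; ring.
Qed.

End BiaddMatrix.

(** * Isoclinism with G_3 and its central quotients *)

Section FourGenerators.
Import GRing.Theory.
Variables (gT : finGroupType) (G : {group gT}) (p d : nat).
Hypothesis p_pr : prime p.

Definition coordinates (f : {morphism G >-> 'rV['F_p]_4})
    (q : {morphism [set: 'rV['F_p]_d] >-> gT}) (b : biadd 'rV['F_p]_4 'rV['F_p]_d) :=
  [/\ 'ker f = 'Z(G), f @* G = setT, 'ker q = 1, q @* setT = G^`(1)
    & forall x y, x \in G -> y \in G -> [~ x, y] = q (b (f x) (f y))].

(** Only the identification of [G / 'Z(G)] with row vectors changes, so the relators can stay fixed
    while the basis adapts to them. *)
Lemma coordinates_change_basis f q b (P : 'M['F_p]_4) : coordinates f q b -> P \in unitmx ->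
  exists (f' : {morphism G >-> 'rV['F_p]_4}) (b' : biadd 'rV['F_p]_4 'rV['F_p]_d),
    coordinates f' q b' /\
    forall i j, b' (delta_mx 0%R i) (delta_mx 0%R j) = b (row i P) (row j P).
Proof.
move=> [kerf imf kerq imq commE] uP.
pose f0 x := (f x *m invmx P)%R; pose b0 u v := b (u *m P)%R (v *m P)%R.
have f0M : {in G &, {morph f0 : x y / x * y}}.
  by move=> x y Gx Gy; rewrite /f0 morphM //= mulmxDl.
have b0l u v w : b0 (u + v)%R w = (b0 u w + b0 v w)%R.
  by rewrite /b0 mulmxDl biaddDl.
have b0r u v w : b0 w (u + v)%R = (b0 w u + b0 w v)%R.
  by rewrite /b0 mulmxDl biaddDr.
exists (Morphism f0M), (Biadd b0l b0r); split; last by move=> i j; rewrite /= /b0 -!rowE.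
have f0K x : (f0 x *m P)%R = f x by rewrite /f0 mulmxKV.
split=> //.
- rewrite -kerf; apply/setP=> x; apply/idP/idP=> kx; have Gx := dom_ker kx.
    have fx : f0 x = 0%R := mker kx.
    by apply/kerP=> //; rewrite -f0K fx mul0mx.
  have fx : f x = 0%R := mker kx.
  by apply/kerP=> //=; rewrite /f0 fx mul0mx.
- apply/setP=> u; rewrite inE; have : (u *m P)%R \in f @* G by rewrite imf inE.
  case/morphimP=> x _ Gx xE; apply/morphimP; exists x => //=.
  by rewrite /f0 -xE mulmxK.
by move=> x y Gx Gy; rewrite commE //= /b0 !f0K.
Qed.

Variables (f : {morphism G >-> 'rV['F_p]_4}) (q : {morphism [set: 'rV['F_p]_d] >-> gT}).
Variable b : biadd 'rV['F_p]_4 'rV['F_p]_d.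
Hypothesis coordG : coordinates f q b.
Let kerf : 'ker f = 'Z(G). Proof. by case: coordG. Qed.
Let imf : f @* G = setT. Proof. by case: coordG. Qed.
Let kerq : 'ker q = 1. Proof. by case: coordG. Qed.
Let imq : q @* setT = G^`(1). Proof. by case: coordG. Qed.
Let commE x y : x \in G -> y \in G -> [~ x, y] = q (b (f x) (f y)).
Proof. by case: coordG => _ _ _ _; apply. Qed.

Lemma coordinates_lift u : exists2 x, x \in G & u = f x.
Proof.
have : u \in f @* G by rewrite imf inE.
by case/morphimP=> x _ Gx ->; exists x.
Qed.

Lemma coordinates_inj u v : q u = q v -> u = v.
Proof.
have /injmP injq : 'injm q by rewrite kerq.
by apply: injq; rewrite inE.
Qed.

Lemma coordinates_alt u : b u u = 0%R.
Proof.
have [x Gx ->] := coordinates_lift u; apply: coordinates_inj.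
by rewrite -commE // commgg morph1.
Qed.

(** The map from the exterior square onto G'. Its kernel is what a subgroup of the centre of [G_3]
    has to match. *)
Let q1fun (w : 'rV['F_p]_6) := q (w *m wedge_mx b)%R.
Let q1M : {in [set: 'rV['F_p]_6] &, {morph q1fun : u v / u * v}}.
Proof. by move=> u v _ _; rewrite /q1fun mulmxDl morphM ?inE. Qed.
Let q1 := Morphism q1M.

Let commE1 x y : x \in G -> y \in G -> [~ x, y] = q1 (wedge (f x) (f y)).
Proof.
move=> Gx Gy; rewrite commE //= /q1fun -biadd_wedge //.
- exact: biaddZl.
- exact: biaddZr.
exact: coordinates_alt.
Qed.

Let imq1 : q1 @* setT = G^`(1).
Proof.
apply/eqP; rewrite eqEsubset; apply/andP; split.
  by apply/subsetP=> _ /morphimP[w _ _ ->]; rewrite -imq; apply: (mem_morphim q); rewrite inE.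
rewrite gen_subG; apply/subsetP=> _ /imset2P[x y Gx Gy ->].
by rewrite commE1 //; apply: (mem_morphim q1); rewrite inE.
Qed.

Let card_kerq1 : (#|'ker q1| * #|G^`(1)| = p ^ 6)%N.
Proof.
rewrite -imq1 card_morphim setIid Lagrange ?subsetIl //.
by rewrite cardsT card_mx card_Fp // mul1n.
Qed.

Lemma coordinates_der1_leq : #|G^`(1)| <= p ^ 6.
Proof. by rewrite -card_kerq1 leq_pmull ?cardG_gt0. Qed.

Local Notation E := (cext (cocycle3 p)).

Lemma cext3_der1 : [set: E]^`(1) = cext_in (cocycle3 p) @* setT.
Proof.
apply/eqP; rewrite eqEsubset cext_der1_sub /=.
apply/subsetP=> _ /morphimP[w _ _ ->].
have : w \in (cext_in (cocycle3 p) @*^-1 [set: E]^`(1))%G.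
  rewrite rV_Fp_group_full ?inE // => k; apply/morphpreP; rewrite inE -gen3_comm //.
  by rewrite mem_commg ?inE.
by case/morphpreP.
Qed.

Lemma cext3_central (w : 'rV['F_p]_6) (x : E) : [~ cext_in (cocycle3 p) w, x] = 1.
Proof. by rewrite cext_commE biadd0l biadd0r subr0. Qed.

Lemma cext3_sub_normal (M : {group E}) : M \subset cext_in (cocycle3 p) @* setT ->
  M <| [set: E].
Proof.
move=> sM; apply: sub_center_normal; apply: subset_trans sM _.
apply/subsetP=> _ /morphimP[w _ _ ->]; apply/centerP; split=> [|x _].
  by rewrite inE.
by apply/commgP; rewrite cext3_central.
Qed.

Lemma isoclinic_G3 : #|G^`(1)| = (p ^ 6)%N -> isoclinic G [set: E]%G.
Proof.
move=> cG'; have kq1 : 'ker q1 = 1.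
  apply: card1_trivg; move/eqP: card_kerq1.
  by rewrite cG' -{2}[(p ^ 6)%N]mul1n eqn_pmul2r ?expn_gt0 ?prime_gt0 // => /eqP.
apply: (isoclinic_crit (f1 := f) (f2 := cext_pr (cocycle3 p)) (q1 := q1)
  (q2 := cext_in (cocycle3 p)) (kappa := @wedge _)) => //.
- rewrite imf; apply/setP=> u; rewrite inE; symmetry; apply/morphimP.
  by exists ((u, 0%R) : E); rewrite ?inE.
- by rewrite kq1 injm_cext_in.
- by rewrite cext3_der1.
- by move=> x y _ _; rewrite inE.
by move=> x y _ _; rewrite cext3_commE.
Qed.

(** [M] lies in the image of the kernel of [q1], and the bound on its order makes it the whole
    image. So the exterior square maps to G' and to the commutator subgroup of the quotient with the
    same kernel. *)
Lemma isoclinic_G3_quotient (S : {set E}) (M := <<S>>%G) :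
  S \subset cext_in (cocycle3 p) @* [set w | w *m wedge_mx b == 0]%R ->
  p ^ 6 <= #|M| * #|G^`(1)| -> M <| [set: E] /\ isoclinic G ([set: E] / M)%G.
Proof.
move=> sS leM.
have grK : group_set [set w : 'rV['F_p]_6 | w *m wedge_mx b == 0]%R.
  apply/group_setP; split=> [|v w]; rewrite !inE; first by rewrite mul0mx.
  by move=> /eqP v0 /eqP w0; rewrite mulmxDl v0 w0 addr0.
have sM : M \subset cext_in (cocycle3 p) @* [set w | w *m wedge_mx b == 0]%R.
  by rewrite -[[set w | _]%R]/(Group grK : {set _}) gen_subG.
pose in3 := cext_in (cocycle3 p); pose H := ([set: E] / M)%G.
have nME : M <| [set: E].
  by apply: cext3_sub_normal; apply: subset_trans sM (morphimS _ (subsetT _)).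
have nM x : x \in 'N(M) by apply: (subsetP (normal_norm nME)); rewrite inE.
have injin : 'injm in3 by rewrite injm_cext_in.
pose q2fun (w : 'rV['F_p]_6) := coset M (in3 w).
have q2M : {in [set: 'rV['F_p]_6] &, {morph q2fun : u v / u * v}}.
  by move=> u v _ _; rewrite /q2fun (morphM in3) ?inE // morphM ?nM.
pose q2 := Morphism q2M.
have kerq2P w : (w \in 'ker q2) = (in3 w \in M).
  apply/idP/idP=> [kw|Mw]; first by apply: coset_idr => //; apply: (mker kw).
  by apply/kerP; rewrite ?inE //= /q2fun coset_id.
have kerq1P w : (w \in 'ker q1) = (w *m wedge_mx b == 0)%R.
  apply/idP/eqP=> [kw|w0].
    by apply: coordinates_inj; rewrite morph1; apply: (mker kw).
  by apply/kerP; rewrite ?inE //= /q1fun w0 morph1.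
have kerq12 : 'ker q1 = 'ker q2.
  apply/esym/eqP; rewrite eqEcard; apply/andP; split.
    apply/subsetP=> w; rewrite kerq2P kerq1P => Mw.
    have /morphimP[w' _] := subsetP sM _ Mw; rewrite inE => w'0 ww'.
    by rewrite (injmP injin w w') ?inE.
  have cM : #|'ker q2| = #|M|.
    rewrite -(card_injm injin (subsetT _)); congr #|pred_of_set _|.
    apply/setP=> x; apply/morphimP/idP=> [[w _ kw xE]|Mx].
      by rewrite xE -kerq2P.
    have /morphimP[w _ _ xw] := subsetP sM x Mx; exists w => //.
    by rewrite kerq2P -[in3 w]xw.
  rewrite -(leq_pmul2r (cardG_gt0 G^`(1))) cM.
  by rewrite card_kerq1.
have kcoset : 'ker (coset M) \subset 'ker (cext_pr (cocycle3 p)).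
  rewrite ker_coset; apply/subsetP=> x Mx.
  have /morphimP[w _ _ ->] := subsetP sM x Mx.
  by apply/kerP; rewrite ?inE.
split=> //; pose f2 := factm_morphism kcoset (normal_norm nME).
have f2E (x : E) : f2 (coset M x) = x.1 by apply: factmE; rewrite inE.
apply: (isoclinic_crit (H := H) (f1 := f) (f2 := f2) (q1 := q1) (q2 := q2)
  (kappa := @wedge _)) => //.
- rewrite imf; apply/setP=> u; rewrite inE; symmetry; apply/morphimP.
  by exists (coset M ((u, 0%R) : E)); rewrite ?f2E // mem_quotient ?inE.
- rewrite -quotient_der ?normal_norm // cext3_der1.
  apply/setP=> y; apply/morphimP/morphimP=> [[w _ _ ->]|[x _ /morphimP[w _ _ ->] ->]].
    by exists (in3 w) => //; apply: (mem_morphim in3); rewrite inE.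
  by exists w; rewrite ?inE.
- by move=> x y _ _; rewrite inE.
move=> _ _ /morphimP[x _ _ ->] /morphimP[y _ _ ->].
by rewrite -morphR // cext3_commE -[coset_morphism M x]/(coset M x) !f2E.
Qed.

End FourGenerators.

Section Relations.
Import GRing.Theory.
Variable p : nat.
Hypotheses (p_pr : prime p) (p_gt2 : 2 < p).
Local Notation E := (cext (cocycle3 p)).
Local Notation in3 := (cext_in (cocycle3 p)).
Local Notation a := (gen3 p o0).
Local Notation b := (gen3 p o1).
Local Notation c := (gen3 p o2).
Local Notation d := (gen3 p o3).

Lemma expgz_cext_in (w : 'rV['F_p]_6) (t : int) : expgz (in3 w) t = in3 (t%:~R *: w)%R.
Proof.
case: t => n.
  by rewrite /= -morphX ?inE // -pmulrn scaler_nat.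
by rewrite /= -morphX ?inE // -morphV ?inE // NegzE mulrNz scaleNr -pmulrn scaler_nat.
Qed.

Definition relator1 : 'rV['F_p]_6 :=
  (delta_mx 0 (@Ordinal 6 0 isT) + delta_mx 0 (@Ordinal 6 5 isT))%R.
Definition relator2 (t : 'F_p) : 'rV['F_p]_6 :=
  (delta_mx 0 (@Ordinal 6 1 isT) + t *: delta_mx 0 (@Ordinal 6 4 isT))%R.

Lemma relator1E : [~ a, b] * [~ c, d] = in3 relator1.
Proof.
rewrite (gen3_comm p (@Ordinal 6 0 isT)) (gen3_comm p (@Ordinal 6 5 isT)).
by rewrite -(morphM in3) ?inE.
Qed.

Lemma relator2E t : [~ a, c] * expgz [~ b, d] t = in3 (relator2 t%:~R%R).
Proof.
rewrite (gen3_comm p (@Ordinal 6 1 isT)) (gen3_comm p (@Ordinal 6 4 isT)).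
by rewrite expgz_cext_in -(morphM in3) ?inE.
Qed.

Lemma card_cycle_cext_in w : w != 0%R -> #|<<[set in3 w]>>| = p.
Proof.
move=> nw; apply: nt_prime_order => //.
  by rewrite -morphX ?inE //= -[_ ^+ p]/(w *+ p)%R rV_Fp_mulrn.
by apply: contraNneq nw => in1; apply/eqP; apply: (congr1 snd in1).
Qed.

Lemma relator1_neq0 : relator1 != 0%R.
Proof.
apply/eqP=> /rowP/(_ (@Ordinal 6 0 isT)); rewrite !mxE /= addr0 => /eqP.
by rewrite oner_eq0.
Qed.

Lemma card_gen_relators t : p ^ 2 <= #|<<[set in3 relator1; in3 (relator2 t)]>>|.
Proof.
set M := <<_>>; have pE : p.-group [set: E].
  by rewrite /pgroup cardsT card_prod !card_mx card_Fp // -expnD pnatX pnat_id.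
have sCM : <[in3 relator1]> \subset M by rewrite cycle_subG mem_gen // set21.
have oC : #|<[in3 relator1]>| = p by apply: card_cycle_cext_in relator1_neq0.
have ltCM : <[in3 relator1]> \proper M.
  apply/properP; split=> //; exists (in3 (relator2 t)); first by rewrite mem_gen // set22.
  (* The coordinate for the pair [a, c] separates the two: it is 1 in [relator2] and 0 in every
     multiple of [relator1]. *)
  apply/negP=> /cycleP[k]; rewrite -morphX ?inE // => /(congr1 snd) /= /rowP.
  move/(_ (@Ordinal 6 1 isT)); rewrite -[(relator1 ^+ k)]/(relator1 *+ k)%R.
  rewrite -scaler_nat !mxE /= addr0 mulr0 => /eqP.
  by rewrite !mulr0 addr0 oner_eq0.
have [k kE] : exists k, #|M| = (p ^ k)%N.
  by have [k kE] := p_natP (pgroupS (subsetT M) pE); exists k.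
have := proper_card ltCM; rewrite oC kE => ltk.
have : p ^ 1 < p ^ k by rewrite expn1.
rewrite (ltn_exp2l _ _ (prime_gt1 p_pr)) => k_gt1.
by apply: (@leq_trans (p ^ k)%N); rewrite ?(leq_exp2l _ _ (prime_gt1 p_pr)) // -kE.
Qed.

End Relations.

(** * Bases adapted to the relators *)

Section AdaptedCoordinates.
Import GRing.Theory.
Variables (gT : finGroupType) (G : {group gT}) (p d : nat).
Hypotheses (p_pr : prime p) (p_gt2 : 2 < p).
Hypothesis classG : forall x, x \in G -> x \notin 'Z(G) -> #|x ^: G| = (p ^ 3)%N.
Hypothesis iZ : #|G : 'Z(G)| = (p ^ 4)%N.
Variables (f : {morphism G >-> 'rV['F_p]_4}) (q : {morphism [set: 'rV['F_p]_d] >-> gT}).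
Variable b : biadd 'rV['F_p]_4 'rV['F_p]_d.
Hypothesis coordG : coordinates f q b.

(** A centraliser has index [p^3] and the centre index [p^4], so [C_G(x)] modulo the centre has
    order [p] and is generated by the image of [x]. *)
Lemma coordinates_aniso u v : u <> 0%R -> b u v = 0%R -> exists c, v = (c *: u)%R.
Proof.
have [kerf imf kerq imq commE] := coordG.
have [x Gx ->] := coordinates_lift coordG u; have [y Gy ->] := coordinates_lift coordG v.
move=> fx0 bxy; have p_gt0 := prime_gt0 p_pr.
have nZx : x \notin 'Z(G) by apply/negP; rewrite -kerf => /mker.
have Cxy : y \in 'C_G[x].
  rewrite inE Gy; apply/cent1P/commute_sym/commgP.
  by rewrite commE // bxy morph1.
have sZC : 'Z(G) \subset 'C_G[x] by rewrite setIS // -cent_set1 centS // sub1set.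
have cardfC : #|f @* 'C_G[x]| = p.
  rewrite card_morphim (setIidPr _) ?subsetIl // kerf.
  have := Lagrange_index (subsetIl G 'C[x]) sZC.
  rewrite index_cent1 classG // iZ (expnS p 3) mulnC => /eqP.
  by rewrite eqn_pmul2r ?expn_gt0 ?p_gt0 // => /eqP.
have fCx : f x \in f @* 'C_G[x] by rewrite mem_morphim // inE Gx cent1id.
have oy : #[f x] = p.
  have := order_dvdG fCx; rewrite cardfC.
  by case/primeP: p_pr => _ H1 /H1 /orP[|/eqP//]; rewrite order_eq1 => /eqP.
have : f y \in <[f x]>.
  have -> : <[f x]> = f @* 'C_G[x].
    by apply/eqP; rewrite eqEcard cycle_subG fCx cardfC -[#|<[f x]>|]/#[f x] oy leqnn.
  by rewrite mem_morphim.
case/cycleP=> k ->; exists (k%:R)%R; by rewrite scaler_nat.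
Qed.

Lemma spans_delta : spans (delta_mx 0 o0 : 'rV['F_p]_4)%R (delta_mx 0 o1)%R
  (delta_mx 0 o2)%R (delta_mx 0 o3)%R.
Proof.
move=> U U0 U1 U2 U3; apply/row_subP => i; rewrite row1.
case: i => [[|[|[|[|//]]]] ilt].
- by rewrite (_ : Ordinal ilt = o0) //; apply: val_inj.
- by rewrite (_ : Ordinal ilt = o1) //; apply: val_inj.
- by rewrite (_ : Ordinal ilt = o2) //; apply: val_inj.
by rewrite (_ : Ordinal ilt = o3) //; apply: val_inj.
Qed.

Lemma coordinates_of_spans y1 y2 y3 y4 (Y := tnth [tuple y1; y2; y3; y4]) :
  spans y1 y2 y3 y4 ->
  exists (f' : {morphism G >-> 'rV['F_p]_4}) (b' : biadd 'rV['F_p]_4 'rV['F_p]_d),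
    coordinates f' q b' /\
    forall i j, b' (delta_mx 0%R i) (delta_mx 0%R j) = b (Y i) (Y j).
Proof.
move=> sp; pose P := (\matrix_i Y i)%R.
have uP : P \in unitmx.
  rewrite -row_full_unit -sub1mx; apply: sp.
  - by rewrite (_ : y1 = row o0 P) ?row_sub // rowK.
  - by rewrite (_ : y2 = row o1 P) ?row_sub // rowK.
  - by rewrite (_ : y3 = row o2 P) ?row_sub // rowK.
  by rewrite (_ : y4 = row o3 P) ?row_sub // rowK.
have [f' [b' [coord' b'E]]] := coordinates_change_basis coordG uP.
by exists f', b'; split=> // i j; rewrite b'E !rowK.
Qed.

Lemma relator1_wedge_mx (b' : biadd 'rV['F_p]_4 'rV['F_p]_d) :
  (relator1 p *m wedge_mx b' = b' (delta_mx 0 o0) (delta_mx 0 o1)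
     + b' (delta_mx 0 o2) (delta_mx 0 o3))%R.
Proof. by rewrite mulmxDl -!rowE !rowK. Qed.

Lemma relator2_wedge_mx t (b' : biadd 'rV['F_p]_4 'rV['F_p]_d) :
  (relator2 t *m wedge_mx b' = b' (delta_mx 0 o0) (delta_mx 0 o2)
     + t *: b' (delta_mx 0 o1) (delta_mx 0 o3))%R.
Proof. by rewrite mulmxDl -scalemxAl -!rowE !rowK. Qed.

Let nz2 : (2%:R != 0 :> 'F_p)%R.
Proof. by rewrite -(dvdn_pcharf (pchar_Fp p_pr)) dvdn_prime2 // gtn_eqF. Qed.

Lemma exists_relation1 : d < 6 ->
  exists y1 y2 y3 y4, spans y1 y2 y3 y4 /\ (b y1 y2 + b y3 y4 = 0)%R.
Proof.
move=> d_lt6; have [w nw] := exists_left_kernel (wedge_mx b) d_lt6.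
rewrite mulmx_sum_row sum6E !rowK.
apply: (adapted_basis1 (biaddZl b) (biaddZr b) (coordinates_alt coordG)
  coordinates_aniso spans_delta).
apply: contra nw => /and5P[/eqP w0 /eqP w1 /eqP w2 /eqP w3 /andP[/eqP w4 /eqP w5]].
apply/eqP/rowP=> k; rewrite mxE.
case: k => [[|[|[|[|[|[|//]]]]]] klt].
- by rewrite -[RHS]w0; congr (w _ _); apply: val_inj.
- by rewrite -[RHS]w1; congr (w _ _); apply: val_inj.
- by rewrite -[RHS]w2; congr (w _ _); apply: val_inj.
- by rewrite -[RHS]w3; congr (w _ _); apply: val_inj.
- by rewrite -[RHS]w4; congr (w _ _); apply: val_inj.
by rewrite -[RHS]w5; congr (w _ _); apply: val_inj.
Qed.

Lemma exists_relation2 (t : 'F_p) : (forall s, s ^+ 2 != t)%R -> d < 5 ->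
  exists y1 y2 y3 y4, [/\ spans y1 y2 y3 y4, (b y1 y2 + b y3 y4 = 0)%R
    & (b y1 y3 + t *: b y2 y4 = 0)%R].
Proof.
move=> nsq_t d_lt5; have [x1 [x2 [x3 [x4 [sp rel1]]]]] := exists_relation1 (ltnW d_lt5).
(* [b x3 x4] is left out because the first relation expresses it by [b x1 x2]; the five remaining
   vectors are dependent in dimension at most 4. *)
pose B := (\matrix_(k < 5) nth 0 [:: b x1 x2; b x1 x3; b x1 x4; b x2 x3; b x2 x4] k)%R.
have [w nw] := exists_left_kernel B d_lt5.
rewrite mulmx_sum_row !big_ord_recl big_ord0 addr0 !addrA !rowK.
move=> rel2.
apply: (adapted_basis2 nz2 (biaddZl b) (biaddZr b) (coordinates_alt coordG)
  coordinates_aniso (fun s nsq_s => nonsquare_ratio nsq_s nsq_t) sp rel1 _ rel2).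
apply: contra nw => /and5P[/eqP w0 /eqP w1 /eqP w2 /eqP w3 /eqP w4].
apply/eqP/rowP=> k; rewrite mxE.
case: k => [[|[|[|[|[|//]]]]] klt].
- by rewrite -[RHS]w0; congr (w _ _); apply: val_inj.
- by rewrite -[RHS]w1; congr (w _ _); apply: val_inj.
- by rewrite -[RHS]w2; congr (w _ _); apply: val_inj.
- by rewrite -[RHS]w3; congr (w _ _); apply: val_inj.
by rewrite -[RHS]w4; congr (w _ _); apply: val_inj.
Qed.

End AdaptedCoordinates.

Theorem theorem1p2 (p : nat) (gT : finGroupType) (G : {group gT}) (t : int) :
  prime p -> 2 < p ->
  p.-group G -> conjugate_type G [:: 1; p ^ 3]%N ->
  ~ square_mod p t ->
  nil_class G = 2 /\
  [\/ exists (hT : finGroupType) (H : {group hT}),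
        [/\ p.-group H, camina H, nil_class H = 2, #|H^`(1)| = (p ^ 3)%N
          & isoclinic G H],
      exists (hT : finGroupType) (G3 : {group hT}) (a b c d : hT),
        presented_G p G3 [tuple a; b; c; d] /\ isoclinic G G3,
      exists (hT : finGroupType) (G3 : {group hT}) (a b c d : hT),
        presented_G p G3 [tuple a; b; c; d] /\
        let M := <<[set [~ a, b] * [~ c, d]]>> in
        M <| G3 /\ isoclinic G (G3 / M)%G
    | exists (hT : finGroupType) (G3 : {group hT}) (a b c d : hT),
        presented_G p G3 [tuple a; b; c; d] /\
        let N := <<[set [~ a, b] * [~ c, d]; [~ a, c] * expgz [~ b, d] t]>> in
        N <| G3 /\ isoclinic G (G3 / N)%G ].
Proof.
move=> p_pr p_gt2 pG typeG nsq; have p_gt1 := prime_gt1 p_pr; have p_gt0 := prime_gt0 p_pr.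
have classG x : x \in G -> x \notin 'Z(G) -> #|x ^: G| = (p ^ 3)%N.
  move=> Gx nZx; have : #|x ^: G| \in [:: 1; p ^ 3]%N.
    by rewrite -typeG; apply: image_f; apply: mem_classes.
  rewrite !inE => /orP[|/eqP //]; rewrite -index_cent1 indexg_eq1 subsetI subxx.
  by rewrite sub_cent1 => cGx; case/negP: nZx; rewrite inE Gx.
have [x Gx nZx] : exists2 x, x \in G & x \notin 'Z(G).
  have : (p ^ 3)%N \in [seq #|xG| | xG : {set gT} in classes G].
    by rewrite typeG !inE eqxx orbT.
  case/imageP=> _ /imsetP[x Gx ->] cx; exists x => //.
  apply/negP=> /centerP[_ cGx]; move/eqP: cx.
  rewrite -index_cent1; have -> : 'C_G[x] = G.
    by apply/setIidPl; rewrite sub_cent1; apply/centP => g /cGx.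
  by rewrite indexgg -(expn0 p) eqn_exp2l.
have G2 := two_class_sizes_odd_class2 p_pr p_gt2 pG classG.
split.
  apply/eqP; rewrite eqn_leq nil_class2 G2 ltnNge nil_class1 /=.
  by apply: contra nZx => abG; rewrite (center_idP abG).
have cD : #|[~: [set x], G]| = (p ^ 3)%N by rewrite (card_comm1 G2 Gx) classG.
have [d dE] := p_natP (pgroupS (der_sub 1 G) pG).
have d_ge3 : 2 < d.
  by rewrite -(leq_exp2l 3 d p_gt1) -dE -cD subset_leq_card // comm1_sub.
case: (ltngtP 3 d) d_ge3 => [d_gt3|//|d3] _; last first.
  by constructor 1; apply: isoclinic_camina p_pr p_gt2 pG classG G2 _; rewrite dE d3.
have abV := abelem_quotient_center p_pr classG G2.
have abD := abelem_der1 p_pr classG G2.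
have iZ : #|G : 'Z(G)| = (p ^ 4)%N.
  by apply: card_quotient_center_p4 => //; rewrite dE ltn_exp2l.
have [f [q [b coordG]]] := class2_coordinates p_pr G2 abV abD iZ dE.
have d_le6 : d <= 6.
  by rewrite -(leq_exp2l d 6 p_gt1) -dE; apply: coordinates_der1_leq coordG.
pose G3 := [set: cext (cocycle3 p)]%G.
have presG3 : presented_G p G3 (gens3 p) by apply: presented_gens3.
(* The number of independent relations is [6 - d]: none, one or two. *)
have [d6|[d5|d4]] : d = 6 \/ d = 5 \/ d = 4 by move: d_le6 d_gt3; clear; lia.
- constructor 2; exists _, G3, (gen3 p o0), (gen3 p o1), (gen3 p o2), (gen3 p o3).
  by split=> //; apply: isoclinic_G3 coordG _; rewrite // dE d6.
- have [|y1 [y2 [y3 [y4 [sp rel]]]]] := exists_relation1 p_pr classG iZ coordG.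
    by rewrite d5.
  have [f' [b' [coord' b'E]]] := coordinates_of_spans coordG sp.
  constructor 3; exists _, G3, (gen3 p o0), (gen3 p o1), (gen3 p o2), (gen3 p o3).
  split=> //; rewrite relator1E; apply: (isoclinic_G3_quotient p_pr coord').
    rewrite sub1set; apply: mem_morphim; rewrite inE //.
    by rewrite relator1_wedge_mx !b'E /= rel.
  by rewrite card_cycle_cext_in ?relator1_neq0 // dE d5 -expnS.
have nsq_t := square_mod_Fp p_pr nsq.
have [|y1 [y2 [y3 [y4 [sp rel1 rel2]]]]] := exists_relation2 p_pr p_gt2 classG iZ coordG nsq_t.
  by rewrite d4.
have [f' [b' [coord' b'E]]] := coordinates_of_spans coordG sp.
constructor 4; exists _, G3, (gen3 p o0), (gen3 p o1), (gen3 p o2), (gen3 p o3).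
split=> //; rewrite relator1E relator2E; apply: (isoclinic_G3_quotient p_pr coord').
  rewrite subUset !sub1set; apply/andP; split; apply: mem_morphim; rewrite inE //.
    by rewrite relator1_wedge_mx !b'E /= rel1.
  by rewrite relator2_wedge_mx !b'E /= rel2.
by rewrite dE d4 (expnD p 2 4) leq_pmul2r ?expn_gt0 ?p_gt0 // card_gen_relators.
Qed.
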